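(* Let $\mu\in(-1,1)$, $\mu\neq 0$, $\mu\neq-\frac12$, and let $\alpha\in[0,1)$, $\beta\ge 0$. Then the radius of $\beta$-uniform convexity of order $\alpha$, $r_{g_\mu}^{\beta-uc(\alpha)}$, of the function $g_\mu$ is the smallest positive root $r$ of the equation $$(1-\alpha)-(1+\beta)\left(\frac12+\mu-r\,\frac{\left(\frac32-\mu\right)s_{\mu-\frac12,\frac12}'(r)+r\,s_{\mu-\frac12,\frac12}''(r)}{\left(\frac12-\mu\right)s_{\mu-\frac12,\frac12}(r)+r\,s_{\mu-\frac12,\frac12}'(r)}\right)=0.$$ Moreover, $r_{g_\mu}^{\beta-uc(\alpha)}<r_{g_\mu}^{c}<\gamma_{\mu,1}<\xi_{\mu,1}$, where $\xi_{\mu,1}$ and $\gamma_{\mu,1}$ denote the first positive zeros of $s_{\mu-\frac12,\frac12}$ and $g_\mu'$, respectively, and $r_{g_\mu}^{c}$ is the radius of convexity of $g_\mu$.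
   Context: Primes on functions denote derivatives. The Lommel function of the first kind is $$s_{\mu,\nu}(z)=\frac{z^{\mu+1}}{(\mu-\nu+1)(\mu+\nu+1)}\,{}_1F_2\left(1;\tfrac{\mu-\nu+3}{2},\tfrac{\mu+\nu+3}{2};-\tfrac{z^2}{4}\right),$$ so that $s_{\mu-\frac12,\frac12}(z)=\frac{z^{\mu+\frac12}}{\mu(\mu+1)}\,{}_1F_2\left(1;\frac{\mu+2}{2},\frac{\mu+3}{2};-\frac{z^2}{4}\right)$. The normalized function is $g_\mu(z)=\mu(\mu+1)z^{-\mu+\frac12}s_{\mu-\frac12,\frac12}(z)=z\,{}_1F_2\left(1;\frac{\mu+2}{2},\frac{\mu+3}{2};-\frac{z^2}{4}\right)$. For $f(z)=z+\sum_{n\ge2}a_nz^n$ with radius of convergence $r_f\in(0,\infty]$ and $U(r)=\{z\in\mathbb{C}:|z|<r\}$, the radius of convexity is $$r_f^{c}=\sup\left\{r\in(0,r_f):\Re\left(1+\frac{zf''(z)}{f'(z)}\right)>0,\ z\in U(r)\right\},$$ and for $\beta\ge0$, $\alpha\in[0,1)$ the radius of $\beta$-uniform convexity of order $\alpha$ is $$r_f^{\beta-uc(\alpha)}=\sup\left\{r\in(0,r_f):\Re\left(1+\frac{zf''(z)}{f'(z)}\right)>\beta\left|\frac{zf''(z)}{f'(z)}\right|+\alpha,\ z\in U(r)\right\}.$$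
   Formalization: For α=β=0 the radius of β-uniform convexity of order α equals the radius of convexity by definition, so the strict inequality between them is false there; it is asserted only when α≠0 or β≠0, with ≤ always, and all other claims are kept for every α, β. *)

(* Defs.v *)
From Stdlib Require Export Reals.
From Coquelicot Require Export Coquelicot.
From Stdlib Require Import Lra Factorial.
Open Scope R_scope.

Fixpoint pochhammer (a : R) (n : nat) : R :=
  match n with
  | O => 1
  | S k => pochhammer a k * (a + INR k)
  end.

Definition hyp1F2_coef (a b c : R) (n : nat) : R :=
  pochhammer a n / (pochhammer b n * pochhammer c n * INR (fact n)).

(* Complex power series with real coefficients; Coquelicot's total [Series] is
   real-valued, hence the componentwise sum. *)
Definition CPSeries (u : nat -> R) (z : C) : C :=
  (Series (fun n => Re (u n * Cpow z n)%C), Series (fun n => Im (u n * Cpow z n)%C)).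

Definition hyp1F2 (a b c x : R) : R := PSeries (hyp1F2_coef a b c) x.
Definition Chyp1F2 (a b c : R) (z : C) : C := CPSeries (hyp1F2_coef a b c) z.

(* Lommel function of the first kind on the positive half-line: [Rpower] is the
   real power only for a positive base. *)
Definition lommel_s (mu nu x : R) : R :=
  Rpower x (mu + 1) / ((mu - nu + 1) * (mu + nu + 1))
  * hyp1F2 1 ((mu - nu + 3) / 2) ((mu + nu + 3) / 2) (- x ^ 2 / 4).

Definition lommel_half (mu : R) : R -> R := lommel_s (mu - 1/2) (1/2).

(* The entire function z 1F2(1; (mu+2)/2, (mu+3)/2; -z^2/4), whose restriction
   to the positive half-line is mu (mu+1) z^(1/2-mu) s_{mu-1/2,1/2}(z); see
   [lommel_g_lommel_half]. *)
Definition lommel_g (mu : R) (z : C) : C :=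
  (z * Chyp1F2 1 ((mu + 2) / 2) ((mu + 3) / 2) (- (z * z) / RtoC 4))%C.

Lemma CPSeries_RtoC (u : nat -> R) (x : R) :
  CPSeries u (RtoC x) = RtoC (PSeries u x).
Proof.
assert (H : forall n, (u n * Cpow (RtoC x) n)%C = RtoC (u n * x ^ n)).
{ intro n. rewrite <- RtoC_pow. symmetry. apply RtoC_mult. }
unfold CPSeries.
rewrite (Series_ext _ (fun n => u n * x ^ n)) by (intro n; now rewrite H).
rewrite (Series_ext (fun n => Im _) (fun n => 0 * 0))
  by (intro n; rewrite H, Rmult_0_l; reflexivity).
rewrite Series_scal_l, Rmult_0_l. reflexivity.
Qed.

Lemma lommel_g_lommel_half (mu x : R) :
  mu <> 0 -> mu + 1 <> 0 -> 0 < x ->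
  lommel_g mu (RtoC x)
  = RtoC (mu * (mu + 1) * Rpower x (- mu + 1/2) * lommel_half mu x).
Proof.
intros Hm Hm1 Hx. unfold lommel_g, Chyp1F2, lommel_half, lommel_s.
replace (- (RtoC x * RtoC x) / RtoC 4)%C with (RtoC (- x ^ 2 / 4)).
2:{ rewrite RtoC_div, RtoC_opp by lra. simpl. rewrite !RtoC_mult. now rewrite Cmult_1_r. }
rewrite CPSeries_RtoC, <- RtoC_mult. f_equal.
replace ((mu - 1 / 2 - 1 / 2 + 3) / 2) with ((mu + 2) / 2) by field.
replace ((mu - 1 / 2 + 1 / 2 + 3) / 2) with ((mu + 3) / 2) by field.
replace (mu - 1 / 2 - 1 / 2 + 1) with mu by field.
replace (mu - 1 / 2 + 1 / 2 + 1) with (mu + 1) by field.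
fold (hyp1F2 1 ((mu + 2) / 2) ((mu + 3) / 2) (- x ^ 2 / 4)).
set (F := hyp1F2 _ _ _ _).
assert (E : Rpower x (- mu + 1/2) * Rpower x (mu - 1/2 + 1) = x).
{ rewrite <- Rpower_plus. replace (_ + _) with 1 by field. now apply Rpower_1. }
rewrite <- E at 1. field. now split.
Qed.

Definition C_derive_n (n : nat) (f : C -> C) : C -> C := Nat.iter n C_derive f.

Definition taylor_coef (f : C -> C) (n : nat) : C :=
  (C_derive_n n f (RtoC 0) / RtoC (INR (fact n)))%C.

(* [CV_radius] only sees absolute values, so it can be fed the moduli. *)
Definition convergence_radius (f : C -> C) : Rbar :=
  CV_radius (fun n => Cmod (taylor_coef f n)).

Definition zf2_f1 (f : C -> C) (z : C) : C :=
  (z * C_derive_n 2 f z / C_derive f z)%C.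

(* [C_derive f z <> 0] makes explicit that z f''/f' must be defined on the
   disc, since division by zero is total in Rocq. *)
Definition radius_of (P : C -> Prop) (f : C -> C) : Rbar :=
  Lub_Rbar (fun r => 0 < r /\ Rbar_lt r (convergence_radius f) /\
    forall z : C, Cmod z < r -> C_derive f z <> RtoC 0 /\ P (zf2_f1 f z)).

Definition convexity_radius (f : C -> C) : Rbar :=
  radius_of (fun w => Re (RtoC 1 + w)%C > 0) f.

Definition uniform_convexity_radius (beta alpha : R) (f : C -> C) : Rbar :=
  radius_of (fun w => Re (RtoC 1 + w)%C > beta * Cmod w + alpha) f.

Definition is_smallest_positive (P : R -> Prop) (x : R) : Prop :=
  0 < x /\ P x /\ forall y, 0 < y < x -> ~ P y.

Definition uc_numerator (mu r : R) : R :=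
  (3/2 - mu) * Derive (lommel_half mu) r + r * Derive_n (lommel_half mu) 2 r.

Definition uc_denominator (mu r : R) : R :=
  (1/2 - mu) * lommel_half mu r + r * Derive (lommel_half mu) r.

Definition uc_equation (mu alpha beta r : R) : Prop :=
  uc_denominator mu r <> 0 /\
  (1 - alpha)
  - (1 + beta) * (1/2 + mu - r * (uc_numerator mu r / uc_denominator mu r)) = 0.

(* Main.v *)
From Stdlib Require Import Lra Lia Wf_nat Factorial FunctionalExtensionality.
Require Import Defs.

(** The function [g = lommel_g mu] is entire, and its derivative is a power series
    [h(z^2)] with [h(x) = 1 - e_1 x + e_2 x^2 - ...], where
    [e_n = (2n+1) / ((mu+2)(mu+3)...(mu+2n+1))]. Everything about convexity is read
    off from [w(z) = z g''(z) / g'(z) = 2 x h'(x) / h(x)] at [x = z^2]. Formally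
    [w = - 2 (p_1 x + p_2 x^2 + ...)], where the [p_k] are obtained from the [e_n]
    by Newton's identities, that is, the power sums of the inverse roots of [h].

    The key point is that all [p_k] are nonnegative. One may deduce it from the
    reality of the zeros of [g'], but a short induction suffices: since
    [(n+1) e_(n+1) <= e_1 e_n] and [4 e_2 <= e_1^2], the terms of Newton's
    alternating sums decrease, which yields
    [e_1 p_k / 2 <= p_(k+1) <= e_1 p_k] ([newton_sum_bounds]). The inequality
    [4 e_2 <= e_1^2] uses [mu < 1] ([lommel_moduli_decay]).

    It follows that [|w(z)| <= - w(|z|)] for [|z|^2 <= 1 / (2 e_1)], and that [- w] is
    strictly increasing on that part of the positive axis. The condition defining the radius of
    uniform convexity holds when [(1 + beta) |w| < 1 - alpha] and fails at
    [w = - (1 - alpha) / (1 + beta)], so the radius is the point where [- w] takes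
    the value [(1 - alpha) / (1 + beta)], and the radius of convexity is the one
    where it takes the value 1 ([radius_of_lommel_g]). As [p_1 = e_1], these points
    satisfy [r^2 < 1 / (2 e_1)] ([power_sum_series_half]); on that disc
    [|h - 1| <= exp(1/2) - 1 < 1], so [g'] has no zero there and the first zero of
    [g'] is larger ([CPSeries_signed_neq_0]). The equation of the theorem is
    [1 - alpha + (1 + beta) w(r) = 0] rewritten through the Lommel function
    ([uc_equation_power_sums]), so its first root is the radius.

    It remains to find a positive zero of [g]; Rolle's theorem then gives an
    earlier zero of [g']. The function [y = x^mu g] satisfies
    [y'' + y = mu (mu+1) x^(mu-1)], and the derivative of its Wronskian with [sin],
    [y' sin - y cos], is that forcing term times [sin x]. For [mu < 0] the forcing
    is negative, whence [y(PI) < 0]; for [mu > 0] it is positive and decreasing,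
    whence [y(2 PI) < 0] ([gR_PI_neg], [gR_2PI_neg]). *)

(** * Absolutely convergent series of complex numbers *)

(** Componentwise, so that [CPSeries] is an instance by conversion. *)
Definition CSeries (v : nat -> C) : C :=
  (Series (fun n => Re (v n)), Series (fun n => Im (v n))).

Definition Csummable (v : nat -> C) : Prop := ex_series (fun n => Cmod (v n)).

Lemma im_le_Cmod (c : C) : Rabs (Im c) <= Cmod c.
Proof.
apply Rle_trans with (2 := Rmax_Cmod c). apply Rmax_r.
Qed.

Lemma Csummable_le (v : nat -> C) (b : nat -> R) :
  (forall n, Cmod (v n) <= b n) -> ex_series b -> Csummable v.
Proof.
intros H Hb. apply (@ex_series_le R_AbsRing R_CompleteNormedModule) with b; [|easy].
intro n. unfold norm; simpl. unfold abs; simpl. rewrite Rabs_right; [apply H|].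
apply Rle_ge, Cmod_ge_0.
Qed.

Lemma Csummable_component (f : C -> R) (v : nat -> C) :
  (forall c, Rabs (f c) <= Cmod c) ->
  Csummable v -> ex_series (fun n => Rabs (f (v n))).
Proof.
intros Hf H. apply (@ex_series_le R_AbsRing R_CompleteNormedModule) with (2 := H).
intro n. unfold norm; simpl. unfold abs; simpl. rewrite Rabs_Rabsolu. apply Hf.
Qed.

Lemma Csummable_Re (v : nat -> C) : Csummable v -> ex_series (fun n => Re (v n)).
Proof. intro H. apply ex_series_Rabs, (Csummable_component Re); [apply re_le_Cmod | easy]. Qed.

Lemma Csummable_Im (v : nat -> C) : Csummable v -> ex_series (fun n => Im (v n)).
Proof. intro H. apply ex_series_Rabs, (Csummable_component Im); [apply im_le_Cmod | easy]. Qed.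

Lemma Csummable_plus (v w : nat -> C) :
  Csummable v -> Csummable w -> Csummable (fun n => (v n + w n)%C).
Proof.
intros Hv Hw. apply Csummable_le with (fun n => Cmod (v n) + Cmod (w n)).
- intro n. apply Cmod_triangle.
- now apply (@ex_series_plus R_AbsRing R_NormedModule).
Qed.

Lemma Csummable_scal (c : C) (v : nat -> C) :
  Csummable v -> Csummable (fun n => (c * v n)%C).
Proof.
intros Hv. apply Csummable_le with (fun n => Cmod c * Cmod (v n)).
- intro n. rewrite Cmod_mult. apply Rle_refl.
- now apply (@ex_series_scal_l R_AbsRing R_NormedModule).
Qed.

Lemma CSeries_ext (v w : nat -> C) : (forall n, v n = w n) -> CSeries v = CSeries w.
Proof.
intro H. unfold CSeries. f_equal; apply Series_ext; intro n; now rewrite H.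
Qed.

Lemma CSeries_plus (v w : nat -> C) :
  Csummable v -> Csummable w ->
  CSeries (fun n => (v n + w n)%C) = (CSeries v + CSeries w)%C.
Proof.
intros Hv Hw. unfold CSeries, Cplus; cbn [fst snd]. f_equal.
- rewrite <- Series_plus by now apply Csummable_Re. now apply Series_ext.
- rewrite <- Series_plus by now apply Csummable_Im. now apply Series_ext.
Qed.

Lemma CSeries_scal (c : C) (v : nat -> C) :
  Csummable v -> CSeries (fun n => (c * v n)%C) = (c * CSeries v)%C.
Proof.
intros Hv. assert (H1 := Csummable_Re _ Hv). assert (H2 := Csummable_Im _ Hv).
unfold CSeries, Cmult; cbn [fst snd]. f_equal.
- rewrite <- 2!Series_scal_l, <- Series_minus; [now apply Series_ext | |];
  now apply (@ex_series_scal_l R_AbsRing R_NormedModule).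
- rewrite <- 2!Series_scal_l, <- Series_plus; [now apply Series_ext | |];
  now apply (@ex_series_scal_l R_AbsRing R_NormedModule).
Qed.

Lemma CSeries_incr_1 (v : nat -> C) :
  Csummable v -> CSeries v = (v O + CSeries (fun n => v (S n)))%C.
Proof.
intros Hv. unfold CSeries, Cplus; cbn [fst snd]. f_equal.
- rewrite Series_incr_1; [easy | now apply Csummable_Re].
- rewrite Series_incr_1; [easy | now apply Csummable_Im].
Qed.

(** Multiplying by the conjugate of the sum turns the bound on the modulus into
    a comparison of the real parts, where no factor is lost. *)
Lemma Cmod_CSeries (v : nat -> C) :
  Csummable v -> Cmod (CSeries v) <= Series (fun n => Cmod (v n)).
Proof.
intros Hv. set (s := CSeries v). set (T := Series _).
assert (H0 := Cmod_ge_0 s).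
destruct (Req_dec (Cmod s) 0) as [E | N].
{ rewrite E. unfold T. rewrite <- (Rmult_0_l (Series (fun _ => 0))), <- Series_scal_l.
  apply Series_le; [|easy]. intro n. rewrite Rmult_0_l.
  split; [lra | apply Cmod_ge_0]. }
apply Rmult_le_reg_l with (Cmod s); [lra|].
assert (E : Re (Cconj s * s)%C = Cmod s * Cmod s).
{ replace (Cmod s * Cmod s) with (Cmod s ^ 2) by ring. rewrite Cmod2_alt.
  destruct s; simpl. unfold Re, Im; simpl. ring. }
rewrite <- E. unfold s at 2. rewrite <- CSeries_scal by easy.
unfold CSeries, Re at 1; cbn [fst]. unfold T. rewrite <- Series_scal_l.
assert (Hw : Csummable (fun n => (Cconj s * v n)%C)) by now apply Csummable_scal.
eapply Rle_trans; [apply Rle_abs|].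
eapply Rle_trans; [apply Series_Rabs|].
{ apply (Csummable_component Re _ re_le_Cmod Hw). }
apply Series_le.
- intro n. split; [apply Rabs_pos|].
  eapply Rle_trans; [apply re_le_Cmod|]. rewrite Cmod_mult, Cmod_conj. apply Rle_refl.
- now apply (@ex_series_scal_l R_AbsRing R_NormedModule).
Qed.

Lemma Re_sum_n (v : nat -> C) n :
  Re (sum_n v n) = sum_f_R0 (fun k => Re (v k)) n.
Proof.
induction n as [|n IH]; [now rewrite sum_O|].
rewrite sum_Sn. cbn [sum_f_R0]. rewrite <- IH. reflexivity.
Qed.

Lemma Im_sum_n (v : nat -> C) n :
  Im (sum_n v n) = sum_f_R0 (fun k => Im (v k)) n.
Proof.
induction n as [|n IH]; [now rewrite sum_O|].
rewrite sum_Sn. cbn [sum_f_R0]. rewrite <- IH. reflexivity.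
Qed.

Lemma CSeries_mult (v w : nat -> C) :
  Csummable v -> Csummable w ->
  CSeries (fun n => sum_n (fun k => (v k * w (n - k)%nat)%C) n)
  = (CSeries v * CSeries w)%C.
Proof.
intros Hv Hw.
assert (M : forall f g : C -> R, (forall c, Rabs (f c) <= Cmod c) ->
  (forall c, Rabs (g c) <= Cmod c) ->
  is_series (fun n => sum_f_R0 (fun k => f (v k) * g (w (n - k)%nat)) n)
   (Series (fun n => f (v n)) * Series (fun n => g (w n)))).
{ intros f g Hf Hg.
  assert (A := Csummable_component f v Hf Hv). assert (B := Csummable_component g w Hg Hw).
  apply (is_series_mult (fun n => f (v n)) (fun n => g (w n))); try easy;
  now apply Series_correct, ex_series_Rabs. }
unfold CSeries, Cmult; cbn [fst snd]. f_equal; apply is_series_unique.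
- eapply is_series_ext; [| exact (@is_series_minus R_AbsRing R_NormedModule _ _ _ _
    (M Re Re re_le_Cmod re_le_Cmod) (M Im Im im_le_Cmod im_le_Cmod))].
  intro n. cbv beta. rewrite Re_sum_n. unfold plus, opp; simpl. fold Rminus.
  symmetry. apply minus_sum.
- eapply is_series_ext; [| exact (@is_series_plus R_AbsRing R_NormedModule _ _ _ _
    (M Re Im re_le_Cmod im_le_Cmod) (M Im Re im_le_Cmod re_le_Cmod))].
  intro n. cbv beta. rewrite Im_sum_n. unfold plus; simpl.
  symmetry. apply plus_sum.
Qed.

(** * Real power series *)

Lemma CV_radius_ge (a : nat -> R) (r M : R) :
  (forall n, Rabs (a n * r ^ n) <= M) -> Rbar_le r (CV_radius a).
Proof.
intro H. apply (proj1 (CV_radius_bounded a)). now exists M.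
Qed.

Lemma CV_radius_p_infty (a : nat -> R) :
  (forall x, 0 < x -> ex_series (fun n => Rabs (a n * x ^ n))) -> CV_radius a = p_infty.
Proof.
intro H. destruct (CV_radius a) as [r| |] eqn:E; [exfalso| easy |exfalso].
- assert (B : Rbar_le (Rmax 0 r + 1) (CV_radius a)).
  { unfold CV_radius. apply Lub_Rbar_correct. apply H. assert (T := Rmax_l 0 r). lra. }
  rewrite E in B. simpl in B. assert (T := Rmax_r 0 r). lra.
- assert (B := CV_radius_ge_0 a). now rewrite E in B.
Qed.

Lemma CV_radius_p_infty_le (a b : nat -> R) :
  (forall n, Rabs (a n) <= Rabs (b n)) -> CV_radius b = p_infty -> CV_radius a = p_infty.
Proof.
intros H Hb. apply CV_radius_p_infty. intros x Hx.
apply (@ex_series_le R_AbsRing R_CompleteNormedModule) with (fun n => Rabs (b n * x ^ n)).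
- intro n. unfold norm; simpl. unfold abs; simpl.
  rewrite Rabs_Rabsolu, !Rabs_mult. apply Rmult_le_compat_r; [apply Rabs_pos | apply H].
- apply CV_disk_inside. now rewrite Hb.
Qed.

Lemma CV_radius_linear (c d : R) (a b : nat -> R) :
  CV_radius a = p_infty -> CV_radius b = p_infty ->
  CV_radius (fun n => c * a n + d * b n) = p_infty.
Proof.
intros Ha Hb. apply CV_radius_p_infty. intros x Hx.
assert (A := CV_disk_inside a x). rewrite Ha in A. specialize (A I).
assert (B := CV_disk_inside b x). rewrite Hb in B. specialize (B I).
apply (@ex_series_le R_AbsRing R_CompleteNormedModule) with
  (fun n => Rabs c * Rabs (a n * x ^ n) + Rabs d * Rabs (b n * x ^ n)).
- intro n. unfold norm; simpl. unfold abs; simpl. rewrite Rabs_Rabsolu, <- !Rabs_mult.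
  replace ((c * a n + d * b n) * x ^ n) with (c * (a n * x ^ n) + d * (b n * x ^ n)) by ring.
  apply Rabs_triang.
- apply (@ex_series_plus R_AbsRing R_NormedModule);
  now apply (@ex_series_scal_l R_AbsRing R_NormedModule).
Qed.

Lemma ex_series_entire (a : nat -> R) (x : R) :
  CV_radius a = p_infty -> ex_series (fun n => a n * x ^ n).
Proof. intro Ha. apply ex_series_Rabs, CV_disk_inside. now rewrite Ha. Qed.

Lemma PSeries_linear (c d : R) (a b : nat -> R) (x : R) :
  CV_radius a = p_infty -> CV_radius b = p_infty ->
  PSeries (fun n => c * a n + d * b n) x = c * PSeries a x + d * PSeries b x.
Proof.
intros Ha Hb. unfold PSeries.
assert (A := ex_series_entire a x Ha). assert (B := ex_series_entire b x Hb).
rewrite <- !Series_scal_l, <- Series_plus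
  by now apply (@ex_series_scal_l R_AbsRing R_NormedModule).
apply Series_ext. intro n. ring.
Qed.

Lemma PSeries_entire_split (a : nat -> R) (x : R) :
  CV_radius a = p_infty -> PSeries a x = a O + x * PSeries (PS_decr_1 a) x.
Proof. intro Ha. apply PSeries_decr_1, CV_radius_inside. now rewrite Ha. Qed.

Lemma PSeries_le_nonneg (a : nat -> R) x y :
  (forall n, 0 <= a n) -> 0 <= x <= y -> Rbar_lt y (CV_radius a) ->
  PSeries a x <= PSeries a y.
Proof.
intros Ha Hx Hy. apply Series_le.
- intro n. split.
  + apply Rmult_le_pos; [apply Ha | now apply pow_le].
  + apply Rmult_le_compat_l; [apply Ha | now apply pow_incr].
- apply (proj1 (ex_pseries_R a y)), CV_radius_inside. rewrite Rabs_right; [easy | lra].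
Qed.

Lemma PSeries_nonneg_ge (a : nat -> R) x :
  (forall n, 0 <= a n) -> 0 <= x -> Rbar_lt x (CV_radius a) -> a O <= PSeries a x.
Proof. intros Ha Hx E. rewrite <- (PSeries_0 a). apply PSeries_le_nonneg; [easy | lra | easy]. Qed.

Lemma PSeries_split (a : nat -> R) x :
  0 <= x -> Rbar_lt x (CV_radius a) ->
  PSeries a x = a O + x * PSeries (PS_decr_1 a) x.
Proof.
intros Hx H. apply PSeries_decr_1, CV_radius_inside. rewrite Rabs_right; [easy | lra].
Qed.

Lemma PSeries_bounded (a : nat -> R) :
  CV_radius a = p_infty ->
  exists B, 0 <= B /\ forall x, 0 <= x <= 1 -> Rabs (PSeries a x) <= B.
Proof.
intro Ha.
assert (A : ex_series (fun n => Rabs (a n))).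
{ eapply ex_series_ext; [|apply (CV_disk_inside a 1); now rewrite Ha].
  intro n. cbv beta. now rewrite pow1, Rmult_1_r. }
assert (K : forall x, 0 <= x <= 1 -> Rabs (PSeries a x) <= Series (fun n => Rabs (a n))).
{ intros x Hx. eapply Rle_trans; [apply Series_Rabs, CV_disk_inside; now rewrite Ha|].
  apply Series_le; [|easy]. intro n. split; [apply Rabs_pos|].
  rewrite Rabs_mult. rewrite <- (Rmult_1_r (Rabs (a n))) at 2. apply Rmult_le_compat_l; [apply Rabs_pos|].
  assert (T : 0 <= x ^ n) by (apply pow_le; lra). rewrite Rabs_right by lra.
  rewrite <- (pow1 n). now apply pow_incr. }
exists (Series (fun n => Rabs (a n))). split; [|easy].
eapply Rle_trans; [apply Rabs_pos | apply (K 0); lra].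
Qed.

(** A power series at the point 1 is a plain series. *)
Lemma is_series_odd_even (v : nat -> R) (l1 l2 : R) :
  is_series (fun n => v (2 * n)%nat) l1 -> is_series (fun n => v (2 * n + 1)%nat) l2 ->
  is_series v (l1 + l2).
Proof.
assert (E : forall (w : nat -> R) x l, x = 1 -> is_series w l <-> is_pseries w x l).
{ intros w x l ->. split; apply is_series_ext; intro n; rewrite pow_n_pow, pow1;
    unfold scal; simpl; unfold mult; simpl; ring. }
intros H1 H2. apply (E _ 1 _ eq_refl). rewrite <- (Rmult_1_l l2) .
apply is_pseries_odd_even; apply E; try easy; ring.
Qed.

(** * Power series with real coefficients at complex points *)

Lemma Cmod_pterm (u : nat -> R) (z : C) n :
  Cmod (u n * Cpow z n)%C = Rabs (u n * Cmod z ^ n).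
Proof.
rewrite Cmod_mult, Cmod_R, Cmod_pow, Rabs_mult. f_equal.
symmetry. apply Rabs_right, Rle_ge, pow_le, Cmod_ge_0.
Qed.

Lemma CPSeries_summable (u : nat -> R) (z : C) :
  Rbar_lt (Cmod z) (CV_radius u) -> Csummable (fun n => (u n * Cpow z n)%C).
Proof.
intro H. eapply ex_series_ext; [intro n; symmetry; apply Cmod_pterm|].
apply CV_disk_inside. rewrite Rabs_right; [easy | apply Rle_ge, Cmod_ge_0].
Qed.

Lemma CPSeries_ext (a b : nat -> R) (z : C) :
  (forall n, a n = b n) -> CPSeries a z = CPSeries b z.
Proof. intro H. apply CSeries_ext. intro n. now rewrite H. Qed.

Lemma CPSeries_0 (u : nat -> R) : CPSeries u (RtoC 0) = RtoC (u O).
Proof. now rewrite CPSeries_RtoC, PSeries_0. Qed.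

Lemma CPSeries_scal (c : R) (u : nat -> R) (z : C) :
  Rbar_lt (Cmod z) (CV_radius u) ->
  CPSeries (fun n => c * u n) z = (RtoC c * CPSeries u z)%C.
Proof.
intro H. change (CPSeries u z) with (CSeries (fun n => (u n * Cpow z n)%C)).
rewrite <- CSeries_scal by now apply CPSeries_summable.
apply CSeries_ext. intro n. rewrite RtoC_mult. ring.
Qed.

Lemma Cmod_CPSeries (u : nat -> R) (z : C) :
  Rbar_lt (Cmod z) (CV_radius u) ->
  Cmod (CPSeries u z) <= PSeries (fun n => Rabs (u n)) (Cmod z).
Proof.
intro H. eapply Rle_trans; [apply Cmod_CSeries, CPSeries_summable, H|].
right. apply Series_ext. intro n. rewrite Cmod_mult, Cmod_pow, Cmod_R. easy.
Qed.

Lemma CPSeries_mult (a b : nat -> R) (z : C) :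
  Rbar_lt (Cmod z) (CV_radius a) -> Rbar_lt (Cmod z) (CV_radius b) ->
  CPSeries (PS_mult a b) z = (CPSeries a z * CPSeries b z)%C.
Proof.
intros Ha Hb.
change (CPSeries a z * CPSeries b z)%C
  with (CSeries (fun n => (a n * Cpow z n)%C) * CSeries (fun n => (b n * Cpow z n)%C))%C.
rewrite <- (CSeries_mult _ _ (CPSeries_summable _ _ Ha) (CPSeries_summable _ _ Hb)).
apply CSeries_ext. intro n. unfold PS_mult.
assert (E : forall m, (m <= n)%nat -> (RtoC (sum_f_R0 (fun k => a k * b (n - k)%nat)%R m) * Cpow z n)%C
  = sum_n (fun k => (a k * Cpow z k * (b (n - k)%nat * Cpow z (n - k)%nat))%C) m).
{ induction m as [|m IH]; intro Hm.
  - rewrite sum_O. cbn [sum_f_R0]. rewrite Nat.sub_0_r, RtoC_mult. simpl. ring.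
  - rewrite sum_Sn. cbn [sum_f_R0]. rewrite <- IH by lia.
    rewrite RtoC_plus, RtoC_mult.
    replace (Cpow z n) with (Cpow z (S m) * Cpow z (n - S m))%C at 1
      by (rewrite <- Cpow_add_r; f_equal; lia).
    replace (Cpow z n) with (Cpow z (S m) * Cpow z (n - S m))%C
      by (rewrite <- Cpow_add_r; f_equal; lia).
    change plus with Cplus. ring. }
now apply E.
Qed.

Lemma CPSeries_ext_terms (a b : nat -> R) (z w : C) :
  (forall n, (RtoC (a n) * Cpow z n)%C = (RtoC (b n) * Cpow w n)%C) ->
  CPSeries a z = CPSeries b w.
Proof. apply CSeries_ext. Qed.

Lemma Csummable_entire (u : nat -> R) (z : C) :
  CV_radius u = p_infty -> Csummable (fun n => (u n * Cpow z n)%C).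
Proof. intro H. apply CPSeries_summable. now rewrite H. Qed.

Lemma Csummable_zero (a : nat -> R) (z : C) :
  (forall n, a n = 0) -> Csummable (fun n => (a n * Cpow z n)%C).
Proof.
intro H. apply Csummable_entire. rewrite (CV_radius_ext _ _ H). apply CV_radius_const_0.
Qed.

Lemma CPSeries_zero (a : nat -> R) (z : C) :
  (forall n, a n = 0) -> CPSeries a z = RtoC 0.
Proof.
intro H. transitivity (CPSeries (fun _ => 0) (RtoC 0)).
- apply CPSeries_ext_terms. intro n. rewrite H. ring.
- apply CPSeries_0.
Qed.

Lemma CPSeries_odd_even (a : nat -> R) (z : C) :
  Csummable (fun n => (a (2 * n)%nat * Cpow (z * z) n)%C) ->
  Csummable (fun n => (a (2 * n + 1)%nat * Cpow (z * z) n)%C) ->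
  CPSeries a z = (CPSeries (fun n => a (2 * n)%nat) (z * z)
                  + z * CPSeries (fun n => a (2 * n + 1)%nat) (z * z))%C.
Proof.
intros He Ho. change (CPSeries (fun n => a (2 * n + 1)%nat) (z * z)%C)
  with (CSeries (fun n => (a (2 * n + 1)%nat * Cpow (z * z) n)%C)).
rewrite <- CSeries_scal by easy.
assert (Ho' := Csummable_scal z _ Ho).
assert (P : forall n, Cpow (z * z) n = Cpow z (2 * n)).
{ intro n. rewrite Cpow_mult_r. f_equal. simpl. ring. }
unfold CPSeries, CSeries, Cplus; cbn [fst snd]. f_equal; apply is_series_unique.
- apply is_series_odd_even.
  + eapply is_series_ext; [|apply Series_correct, (Csummable_Re _ He)].
    intro n. cbv beta. now rewrite P.
  + eapply is_series_ext; [|apply Series_correct, (Csummable_Re _ Ho')].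
    intro n. cbv beta. rewrite P, Nat.add_1_r, Cpow_S. f_equal. ring.
- apply is_series_odd_even.
  + eapply is_series_ext; [|apply Series_correct, (Csummable_Im _ He)].
    intro n. cbv beta. now rewrite P.
  + eapply is_series_ext; [|apply Series_correct, (Csummable_Im _ Ho')].
    intro n. cbv beta. rewrite P, Nat.add_1_r, Cpow_S. f_equal. ring.
Qed.

(** * Termwise complex differentiation *)

(** A crude second-order remainder, proved by induction on the exponent. Writing
    the bound with [rho >= 1] and without exponents [n - 1] or [n - 2] avoids
    treating small [n] separately. *)
Lemma Cpow_taylor2 (z h : C) (rho : R) (n : nat) :
  1 <= rho -> Cmod z + Cmod h <= rho ->
  Cmod (Cpow (z + h) n - Cpow z n - INR n * h * Cpow z (Init.Nat.pred n))%C
  <= Cmod h * Cmod h * (INR n * INR n * rho ^ n).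
Proof.
intros H1 Hr. assert (Hz := Cmod_ge_0 z). assert (Hh := Cmod_ge_0 h).
induction n as [|n IH].
{ simpl. replace (1 - 1 - 0 * h * 1)%C with (RtoC 0) by ring. rewrite Cmod_0. lra. }
replace (Cpow (z + h) (S n) - Cpow z (S n) - INR (S n) * h * Cpow z (Init.Nat.pred (S n)))%C
  with ((z + h) * (Cpow (z + h) n - Cpow z n - INR n * h * Cpow z (Init.Nat.pred n))
        + h * h * (INR n * Cpow z (Init.Nat.pred n)))%C.
2:{ rewrite S_INR, RtoC_plus. destruct n; simpl; ring. }
eapply Rle_trans; [apply Cmod_triangle|]. rewrite !Cmod_mult.
assert (Hp : Cmod (RtoC (INR n)) * Cmod (Cpow z (Init.Nat.pred n)) <= INR n * rho ^ S n).
{ rewrite Cmod_R, Cmod_pow, Rabs_right by apply Rle_ge, pos_INR.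
  apply Rmult_le_compat_l; [apply pos_INR|].
  apply Rle_trans with (rho ^ Init.Nat.pred n).
  - apply pow_incr. lra.
  - apply Rle_pow; [easy | lia]. }
assert (Hq : Cmod (z + h) <= rho) by (eapply Rle_trans; [apply Cmod_triangle | easy]).
assert (Hn := pos_INR n).
assert (Hrho : 0 < rho ^ n) by (apply pow_lt; lra).
apply Rle_trans with (rho * (Cmod h * Cmod h * (INR n * INR n * rho ^ n))
   + Cmod h * Cmod h * (INR n * rho ^ S n)).
- apply Rplus_le_compat.
  + apply Rmult_le_compat; try apply Cmod_ge_0; easy.
  + apply Rmult_le_compat_l; [nra | easy].
- rewrite S_INR. simpl pow.
  assert (0 <= Cmod h * Cmod h * (rho * rho ^ n)) by (repeat apply Rmult_le_pos; lra).
  nra.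
Qed.

Lemma INR_sqr_le_pow4 n : INR n * INR n <= 4 ^ n.
Proof.
assert (H : INR n <= 2 ^ n).
{ induction n as [|n IH]; [simpl; lra|]. rewrite S_INR. simpl.
  assert (1 <= 2 ^ n) by (apply pow_R1_Rle; lra). lra. }
replace (4 ^ n) with (2 ^ n * 2 ^ n).
- apply Rmult_le_compat; try apply pos_INR; exact H.
- rewrite <- Rpow_mult_distr. f_equal; ring.
Qed.

(** [C_derive] takes the limit of the difference quotient along the horizontal
    direction, one component at a time; hence real increments suffice. *)
Lemma C_derive_of_quadratic_error (f : C -> C) (z l : C) (M : R) :
  (forall h : R, Rabs h <= 1 ->
    Cmod (f (z + RtoC h) - f z - RtoC h * l)%C <= M * (h * h)) ->
  C_derive f z = l.
Proof.
intro H. destruct l as [l1 l2] eqn:El. rewrite <- El in H.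
unfold C_derive, C_lim.
assert (HM : 0 <= M).
{ specialize (H 1). rewrite Rabs_R1 in H. specialize (H (Rle_refl 1)).
  assert (G := Cmod_ge_0 (f (z + RtoC 1) - f z - RtoC 1 * l)%C). lra. }
assert (L : forall (p : C -> R), (forall c, Rabs (p c) <= Cmod c) ->
   (forall a b, p (a - b)%C = p a - p b) ->
   is_lim (fun x => p ((f (x, snd z) - f z) / ((x, snd z) - z))%C) (fst z) (p l)).
{ intros p Hp Hm. apply is_lim_spec. intro eps.
  assert (Hd : 0 < Rmin 1 (eps / (M + 1))).
  { apply Rmin_glb_lt; [lra|]. apply Rdiv_lt_0_compat; [apply cond_pos | lra]. }
  exists (mkposreal _ Hd). intros x'. change R in x'. rename x' into x. intros Hx Hn.
  change (x <> fst z) in Hn.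
  change (Rabs (x - fst z) < Rmin 1 (eps / (M + 1))) in Hx.
  set (h := x - fst z) in *.
  assert (Hh1 : Rabs h < 1) by (eapply Rlt_le_trans; [exact Hx | apply Rmin_l]).
  assert (Hh2 : Rabs h < eps / (M + 1)) by (eapply Rlt_le_trans; [exact Hx | apply Rmin_r]).
  assert (Hh0 : h <> 0) by (unfold h; lra).
  assert (E1 : (x, snd z) = (z + RtoC h)%C).
  { destruct z; unfold h, RtoC, Cplus; simpl. f_equal; ring. }
  assert (E2 : ((x, snd z) - z)%C = RtoC h) by (rewrite E1; ring).
  rewrite E2, E1. rewrite <- Hm.
  eapply Rle_lt_trans; [apply Hp|].
  assert (Hc : RtoC h <> RtoC 0) by (intro E; apply Hh0; now injection E).
  replace ((f (z + RtoC h) - f z) / RtoC h - l)%C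
    with ((f (z + RtoC h) - f z - RtoC h * l) / RtoC h)%C by (field; easy).
  rewrite Cmod_div, Cmod_R by easy.
  assert (Hpos : 0 < Rabs h) by now apply Rabs_pos_lt.
  apply Rle_lt_trans with (M * Rabs h).
  - apply Rmult_le_reg_r with (Rabs h); [easy|].
    unfold Rdiv. rewrite Rmult_assoc, Rinv_l, Rmult_1_r by lra.
    eapply Rle_trans; [apply H; lra|]. right. rewrite Rmult_assoc.
    f_equal. rewrite <- Rabs_mult. symmetry. apply Rabs_right. nra.
  - apply Rle_lt_trans with ((M + 1) * Rabs h); [nra|].
    rewrite Rmult_comm. apply Rmult_lt_reg_r with (/ (M + 1)).
    + apply Rinv_0_lt_compat; lra.
    + rewrite Rmult_assoc, Rinv_r by lra. rewrite Rmult_1_r. exact Hh2. }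
rewrite El in L.
f_equal.
- exact (f_equal real (is_lim_unique _ _ _ (L Re re_le_Cmod (fun a b => eq_refl)))).
- exact (f_equal real (is_lim_unique _ _ _ (L Im im_le_Cmod (fun a b => eq_refl)))).
Qed.

(** The second-order remainders of the monomials sum to a multiple of [h * h]; the
    factor [n * n] of the remainder is absorbed by enlarging the evaluation
    point four times. *)
Lemma C_derive_CPSeries (u : nat -> R) (z : C) :
  CV_radius u = p_infty -> C_derive (CPSeries u) z = CPSeries (PS_derive u) z.
Proof.
intro Hu.
assert (Hall : forall (w : C), Csummable (fun n => (u n * Cpow w n)%C)).
{ intro w. apply CPSeries_summable. now rewrite Hu. }
set (rho := Cmod z + 1). assert (Hz := Cmod_ge_0 z).
assert (Hb : ex_series (fun n => INR n * INR n * Rabs (u n) * rho ^ n)).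
{ apply (@ex_series_le R_AbsRing R_CompleteNormedModule) with
    (fun n => Rabs (u n * (4 * rho) ^ n)).
  2:{ apply CV_disk_inside. now rewrite Hu. }
  intro n. unfold norm; simpl. unfold abs; simpl.
  assert (0 <= rho ^ n) by (apply pow_le; unfold rho; lra).
  assert (Hn := pos_INR n). assert (Ha := Rabs_pos (u n)). assert (H4 := INR_sqr_le_pow4 n).
  rewrite Rabs_right by (apply Rle_ge; repeat apply Rmult_le_pos; easy).
  rewrite Rabs_mult, Rpow_mult_distr, (Rabs_right (_ * _))
    by (apply Rle_ge, Rmult_le_pos; [apply pow_le; lra | easy]).
  assert (0 <= Rabs (u n) * rho ^ n) by (now apply Rmult_le_pos). nra. }
apply (C_derive_of_quadratic_error _ _ _ (Series (fun n => INR n * INR n * Rabs (u n) * rho ^ n))).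
intros h Hh.
set (d := fun n => (INR n * u n * Cpow z (Init.Nat.pred n))%C).
assert (Hd : Csummable d).
{ apply Csummable_le with (2 := Hb). intro n. unfold d. rewrite !Cmod_mult, !Cmod_R, Cmod_pow.
  rewrite (Rabs_right (INR n)) by apply Rle_ge, pos_INR.
  assert (P : INR n * Cmod z ^ Init.Nat.pred n <= INR n * INR n * rho ^ n).
  { destruct n as [|n]; [simpl; lra|].
    assert (1 <= INR (S n)) by (rewrite S_INR; assert (T := pos_INR n); lra).
    assert (Cmod z ^ n <= rho ^ S n).
    { apply Rle_trans with (rho ^ n); [apply pow_incr; unfold rho; lra|].
      apply Rle_pow; [unfold rho; lra | lia]. }
    assert (0 <= Cmod z ^ n) by now apply pow_le.
    cbn [Init.Nat.pred]. rewrite Rmult_assoc. apply Rmult_le_compat_l; [lra|]. nra. }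
  assert (Ha := Rabs_pos (u n)). nra. }
assert (E : CPSeries (PS_derive u) z = CSeries d).
{ rewrite (CSeries_incr_1 d Hd).
  replace (d O) with (RtoC 0) by (unfold d; simpl; ring). rewrite Cplus_0_l.
  apply CSeries_ext. intro n. unfold d, PS_derive. rewrite RtoC_mult. reflexivity. }
rewrite E.
set (v := fun n => (u n * Cpow (z + h) n)%C). set (w := fun n => (u n * Cpow z n)%C).
change (CPSeries u (z + h)%C) with (CSeries v). change (CPSeries u z) with (CSeries w).
assert (Hv : Csummable v) by apply Hall. assert (Hw : Csummable w) by apply Hall.
assert (Hw1 := Csummable_scal (RtoC (-1)) _ Hw).
assert (Hd1 := Csummable_scal (- RtoC h)%C _ Hd).
assert (Hvw := Csummable_plus _ _ Hv Hw1). assert (Ht := Csummable_plus _ _ Hvw Hd1).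
replace (CSeries v - CSeries w - h * CSeries d)%C
  with (CSeries v + RtoC (-1) * CSeries w + (- RtoC h) * CSeries d)%C by ring.
rewrite <- !CSeries_scal, <- !CSeries_plus by easy.
eapply Rle_trans; [apply Cmod_CSeries, Ht|].
rewrite <- Series_scal_r. apply Series_le.
2:{ now apply ex_series_scal_r. }
intro n. split; [apply Cmod_ge_0|].
replace (v n + RtoC (-1) * w n + - h * d n)%C
  with (u n * (Cpow (z + h) n - Cpow z n - INR n * h * Cpow z (Init.Nat.pred n)))%C
  by (unfold v, w, d; ring).
rewrite Cmod_mult, Cmod_R.
assert (T := Cpow_taylor2 z (RtoC h) rho n). rewrite Cmod_R in T.
assert (Hs : Rabs h * Rabs h = h * h) by (rewrite <- Rabs_mult; apply Rabs_right; nra).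
rewrite Hs in T.
apply Rle_trans with (Rabs (u n) * (h * h * (INR n * INR n * rho ^ n))); [|right; ring].
apply Rmult_le_compat_l; [apply Rabs_pos|]. apply T; unfold rho; lra.
Qed.

Lemma C_derive_n_CPSeries (u : nat -> R) (n : nat) :
  CV_radius u = p_infty -> C_derive_n n (CPSeries u) = CPSeries (PS_derive_n n u).
Proof.
intro Hu. induction n as [|n IH].
- apply functional_extensionality. intro z. apply CPSeries_ext. intro k.
  unfold PS_derive_n. rewrite Nat.add_0_r. field. apply INR_fact_neq_0.
- apply functional_extensionality. intro z. cbn [C_derive_n Nat.iter]. fold (C_derive_n n).
  change (C_derive (C_derive_n n (CPSeries u)) z = CPSeries (PS_derive_n (S n) u) z).
  rewrite IH, C_derive_CPSeries by now rewrite CV_radius_derive_n.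
  apply CPSeries_ext. intro k. unfold PS_derive, PS_derive_n.
  replace (k + S n)%nat with (S k + n)%nat by lia.
  rewrite (fact_simpl k), mult_INR. field. split; [apply INR_fact_neq_0 | apply not_0_INR; lia].
Qed.

(** The Taylor coefficients at 0 give back the coefficients, by evaluating
    the [n]-th derivative, itself a power series, at 0. *)
Lemma convergence_radius_CPSeries (u : nat -> R) :
  CV_radius u = p_infty -> convergence_radius (CPSeries u) = p_infty.
Proof.
intro Hu. unfold convergence_radius.
rewrite (CV_radius_ext _ (fun n => Rabs (u n))).
- assert (B : Rbar_le p_infty (CV_radius (fun n => Rabs (u n)))).
  { rewrite <- Hu. unfold CV_radius at 1. apply Lub_Rbar_correct.
    intros r Hr. apply Lub_Rbar_correct. unfold CV_disk in *.
    eapply ex_series_ext; [|exact Hr]. intro n. cbv beta.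
    now rewrite !Rabs_mult, Rabs_Rabsolu. }
  destruct (CV_radius (fun n => Rabs (u n))); simpl in B; easy.
- intro n. unfold taylor_coef. rewrite C_derive_n_CPSeries, CPSeries_0 by easy.
  unfold PS_derive_n. cbn [fact Nat.add]. rewrite <- RtoC_div by apply INR_fact_neq_0.
  rewrite Cmod_R. f_equal. simpl (INR 1). field. apply INR_fact_neq_0.
Qed.

(** * Newton's identities for rapidly decreasing coefficients *)

Lemma alternating_sum_bounds (n : nat) (s : nat -> R) :
  (forall i, (i <= n)%nat -> 0 <= s i) ->
  (forall i, (i < n)%nat -> s (S i) <= s i) ->
  0 <= sum_f_R0 (fun i => (-1) ^ i * s i) n <= s O.
Proof.
revert s. induction n as [|n IH]; intros s H0 Hd.
- simpl. specialize (H0 O (le_n _)). lra.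
- rewrite decomp_sum by lia. cbn [Init.Nat.pred].
  rewrite (sum_eq _ (fun i => ((-1) ^ i * s (S i)) * -1)) by (intros; simpl; ring).
  rewrite <- scal_sum.
  assert (B := IH (fun i => s (S i))). cbv beta in B.
  destruct B as [B1 B2].
  + intros i Hi. apply H0. lia.
  + intros i Hi. apply Hd. lia.
  + assert (D := Hd O ltac:(lia)). simpl pow. lra.
Qed.

Lemma alternating_sum_ge (n : nat) (s : nat -> R) :
  (forall i, (i <= S n)%nat -> 0 <= s i) ->
  (forall i, (i < S n)%nat -> s (S i) <= s i) ->
  s O - s 1%nat <= sum_f_R0 (fun i => (-1) ^ i * s i) (S n).
Proof.
intros H0 Hd. rewrite decomp_sum by lia. cbn [Init.Nat.pred].
rewrite (sum_eq _ (fun i => ((-1) ^ i * s (S i)) * -1)) by (intros; simpl; ring).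
rewrite <- scal_sum.
destruct (alternating_sum_bounds n (fun i => s (S i))) as [B1 B2].
- intros i Hi. apply H0. lia.
- intros i Hi. apply Hd. lia.
- simpl pow. lra.
Qed.

(** Course-of-values recursion: [newton_prefix c n] holds the first [n] values
    and vanishes beyond them. *)
Fixpoint newton_prefix (c : nat -> R) (n : nat) : nat -> R :=
  match n with
  | O => fun _ => 0
  | S m => fun k =>
      if Nat.eqb k m
      then - (INR m * c m) - PS_mult c (newton_prefix c m) m
      else newton_prefix c m k
  end.

(** If [c] lists the coefficients of the product of the [1 - x / a_i], this is
    the power sum of the [a_i ^ -k]; its generating series is
    [- x h'(x) / h(x)], where [h] has the coefficients [c]. The value at 0 is 0. *)
Definition newton_sum (c : nat -> R) (k : nat) : R := newton_prefix c (S k) k.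

Lemma newton_prefix_lt c n k : (k < n)%nat -> newton_prefix c n k = newton_sum c k.
Proof.
induction n as [|n IH]; intro H; [lia|].
destruct (Nat.eq_dec k n) as [->|N]; [reflexivity|].
cbn [newton_prefix]. apply Nat.eqb_neq in N. rewrite N. apply Nat.eqb_neq in N. apply IH. lia.
Qed.

Lemma newton_prefix_ge c n k : (n <= k)%nat -> newton_prefix c n k = 0.
Proof.
induction n as [|n IH]; intro H; [easy|].
cbn [newton_prefix]. replace (Nat.eqb k n) with false by (symmetry; apply Nat.eqb_neq; lia).
apply IH. lia.
Qed.

(** The coefficientwise form of [h * P = - x h']. *)
Lemma newton_identity c n :
  c O = 1 -> PS_mult c (newton_sum c) n = - (INR n * c n).
Proof.
intro Hc. unfold PS_mult.
assert (E : newton_sum c n = - (INR n * c n) - PS_mult c (newton_prefix c n) n).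
{ unfold newton_sum. cbn [newton_prefix]. now rewrite Nat.eqb_refl. }
destruct n as [|n].
- cbn [sum_f_R0 Nat.sub]. rewrite E. unfold PS_mult. simpl. rewrite Hc. ring.
- rewrite decomp_sum, Nat.sub_0_r, E, Hc by lia. unfold PS_mult.
  rewrite decomp_sum, Nat.sub_0_r, newton_prefix_ge by lia. cbn [Init.Nat.pred].
  rewrite (sum_eq (fun k => c (S k) * newton_prefix c (S n) _)
                  (fun k => c (S k) * newton_sum c (S n - S k)%nat)); [ring|].
  intros i Hi. rewrite newton_prefix_lt by lia. reflexivity.
Qed.

Lemma newton_sum_0 c : newton_sum c O = 0.
Proof. unfold newton_sum; simpl. unfold PS_mult; simpl. ring. Qed.

Definition signed (e : nat -> R) (n : nat) : R := (-1) ^ n * e n.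

(** [decay_ratio] makes the coefficients smaller than those of [exp (e 1 * x)],
    and [decay_2] says that the quadratic [x^2 - e 1 * x + e 2] has real roots;
    its mid-point [e 1 / 2] is the growth rate that the induction below
    propagates. *)
Record newton_decay (e : nat -> R) : Prop := {
  decay_0 : e O = 1;
  decay_pos : forall n, 0 < e n;
  decay_ratio : forall n, INR (S n) * e (S n) <= e 1%nat * e n;
  decay_2 : 4 * e 2%nat <= e 1%nat * e 1%nat }.

(** In Newton's identity for the [k]-th power sum the last term is [k * e k], as
    if the power sum of order 0 were [k]. *)
Definition newton_weight (p : nat -> R) (k i : nat) : R :=
  match i with O => INR k | _ => p i end.

Lemma newton_sum_alternating (e : nat -> R) (k : nat) :
  e O = 1 ->
  newton_sum (signed e) (S k)
  = sum_f_R0 (fun i => (-1) ^ i *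
      (e (S i) * newton_weight (newton_sum (signed e)) (S k) (k - i)%nat)) k.
Proof.
intro H0. set (p := newton_sum (signed e)).
assert (Hc : signed e O = 1) by (unfold signed; simpl; rewrite H0; ring).
assert (E := newton_identity (signed e) (S k) Hc). fold p in E. unfold PS_mult in E.
rewrite decomp_sum, Nat.sub_0_r, Hc in E by lia. cbn [Init.Nat.pred] in E.
assert (P0 : p O = 0) by apply newton_sum_0.
destruct k as [|k].
- simpl in *. rewrite P0 in E. unfold signed in E. simpl in *. lra.
- rewrite tech5 in E |- *. rewrite !Nat.sub_diag in *. rewrite P0 in E.
  rewrite (sum_eq _ (fun i => (signed e (S i) * p (S (S k) - S i)%nat) * -1)).
  2:{ intros i Hi. unfold newton_weight, signed.
      replace (S (S k) - S i)%nat with (S k - i)%nat by lia.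
      destruct (S k - i)%nat eqn:D; [lia|]. simpl. ring. }
  rewrite <- scal_sum. unfold newton_weight. unfold signed in E at 2 3.
  cbn [pow] in *. lra.
Qed.

(** The terms [e i * p (k - i)] of Newton's identity decrease in [i]: passing to
    the next one multiplies the power sum by at most [2 / e 1], by induction, and
    the coefficient by at most [e 1 / 2], by [decay_ratio]. The
    alternating sum therefore lies between [e 1 * p (k - 1)] and the difference of
    its first two terms, which [decay_2] bounds below by half of the first one. *)
Lemma newton_sum_bounds (e : nat -> R) (k : nat) :
  newton_decay e ->
  0 < newton_sum (signed e) (S k) /\
  e 1%nat * newton_sum (signed e) (S k) <= 2 * newton_sum (signed e) (S (S k)) /\
  newton_sum (signed e) (S (S k)) <= e 1%nat * newton_sum (signed e) (S k).
Proof.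
intros [H0 Hpos Hr H2]. set (p := newton_sum (signed e)).
assert (A : forall k, p (S k) = sum_f_R0 (fun i => (-1) ^ i *
      (e (S i) * newton_weight p (S k) (k - i)%nat)) k)
  by (intro; now apply newton_sum_alternating).
assert (He1 := Hpos 1%nat).
assert (P1 : p 1%nat = e 1%nat) by (rewrite A; simpl; ring).
induction k as [k IH] using lt_wf_ind.
assert (Hk : 0 < p (S k)).
{ destruct k as [|k]; [now rewrite P1|]. destruct (IH k ltac:(lia)) as [I1 [I2 _]].
  assert (0 < e 1%nat * p (S k)) by now apply Rmult_lt_0_compat. lra. }
split; [easy|].
set (s := fun i => e (S i) * newton_weight p (S (S k)) (S k - i)%nat).
assert (S0 : forall i, (i <= S k)%nat -> 0 <= s i).
{ intros i Hi. apply Rmult_le_pos; [now left; apply Hpos|]. unfold newton_weight.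
  destruct (S k - i)%nat as [|j] eqn:D; [apply pos_INR|].
  destruct (Nat.eq_dec j k) as [->|N]; [now left|].
  left. apply (IH j). lia. }
assert (Sd : forall i, (i < S k)%nat -> s (S i) <= s i).
{ intros i Hi. unfold s.
  replace (S k - S i)%nat with (k - i)%nat by lia.
  replace (S k - i)%nat with (S (k - i)) by lia.
  destruct (k - i)%nat as [|j] eqn:D; cbn [newton_weight].
  - assert (i = k) by lia. subst i. rewrite P1.
    rewrite Rmult_comm, (Rmult_comm (e (S k))). apply Hr.
  - destruct (IH j ltac:(lia)) as [I1 [I2 _]].
    assert (R := Hr (S i)). assert (E1 := Hpos (S (S i))). assert (E0 := Hpos (S i)).
    assert (Hpj : 0 <= p (S (S j))) by nra.
    assert (R2 : 2 * e (S (S i)) <= e 1%nat * e (S i)).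
    { eapply Rle_trans; [|exact R]. apply Rmult_le_compat_r; [lra|].
      rewrite !S_INR. assert (T := pos_INR i). lra. }
    apply Rmult_le_reg_l with (e 1%nat); [easy|].
    apply Rle_trans with (e (S (S i)) * (2 * p (S (S j)))); [nra|].
    nra. }
assert (E2 : s O = e 1%nat * p (S k)) by reflexivity.
split.
- rewrite (A (S k)). assert (B := alternating_sum_ge k s S0 Sd).
  fold s.
  assert (S1 : 2 * s 1%nat <= e 1%nat * p (S k)).
  { unfold s. cbn [Nat.sub]. rewrite Nat.sub_0_r. destruct k as [|j]; cbn [newton_weight].
    - simpl INR. rewrite P1. lra.
    - destruct (IH j ltac:(lia)) as [I1 [I2 _]]. assert (E3 := Hpos 2%nat). nra. }
  change (fun i => (-1) ^ i * (e (S i) * newton_weight p (S (S k)) (S k - i))) with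
    (fun i => (-1) ^ i * s i). lra.
- rewrite (A (S k)).
  change (fun i => (-1) ^ i * (e (S i) * newton_weight p (S (S k)) (S k - i))) with
    (fun i => (-1) ^ i * s i).
  rewrite <- E2. now apply alternating_sum_bounds.
Qed.

Lemma newton_sum_1 e : e O = 1 -> newton_sum (signed e) 1 = e 1%nat.
Proof. intro H. rewrite newton_sum_alternating by easy. simpl. ring. Qed.

Lemma newton_sum_nonneg e k : newton_decay e -> 0 <= newton_sum (signed e) k.
Proof.
intro H. destruct k as [|k]; [rewrite newton_sum_0; lra|]. left. now apply newton_sum_bounds.
Qed.

Lemma newton_sum_geom e k :
  newton_decay e -> newton_sum (signed e) (S k) <= e 1%nat ^ S k.
Proof.
intro H. induction k as [|k IH].
- rewrite newton_sum_1 by apply H. lra.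
- destruct (newton_sum_bounds e k H) as [_ [_ B]]. eapply Rle_trans; [exact B|].
  cbn [pow] in *. apply Rmult_le_compat_l; [left; apply H | easy].
Qed.

Lemma CV_radius_newton_sum e x :
  newton_decay e -> x < / e 1%nat -> Rbar_lt x (CV_radius (newton_sum (signed e))).
Proof.
intros H Hx. apply Rbar_lt_le_trans with (/ e 1%nat); [exact Hx|].
apply CV_radius_ge with 1. intro n.
assert (He := decay_pos e H 1%nat).
destruct n as [|n].
- rewrite newton_sum_0, Rmult_0_l, Rabs_R0. lra.
- assert (0 < e 1%nat ^ S n) by now apply pow_lt.
  assert (B := newton_sum_geom e n H). assert (B0 := newton_sum_nonneg e (S n) H).
  rewrite pow_inv. assert (Hi := Rinv_0_lt_compat _ H0).
  rewrite Rabs_right by (apply Rle_ge; apply Rmult_le_pos; lra).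
  apply Rmult_le_reg_r with (e 1%nat ^ S n); [easy|].
  rewrite Rmult_assoc, Rinv_l by lra. lra.
Qed.

Lemma decay_fact e n : newton_decay e -> e n <= e 1%nat ^ n / INR (fact n).
Proof.
intro H. assert (He := decay_pos e H 1%nat).
induction n as [|n IH].
- simpl. rewrite (decay_0 e H). lra.
- assert (Hf := INR_fact_lt_0 n). assert (Hs : 0 < INR (S n)) by (apply lt_0_INR; lia).
  rewrite fact_simpl, mult_INR.
  apply Rmult_le_reg_l with (INR (S n)); [easy|].
  eapply Rle_trans; [apply (decay_ratio e H)|].
  replace (INR (S n) * (e 1%nat ^ S n / (INR (S n) * INR (fact n))))
    with (e 1%nat * (e 1%nat ^ n / INR (fact n))) by (simpl pow; field; lra).
  apply Rmult_le_compat_l; lra.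
Qed.

Lemma Rabs_signed e n : 0 <= e n -> Rabs (signed e n) = e n.
Proof.
intro H. unfold signed. rewrite Rabs_mult, pow_1_abs, Rmult_1_l.
now apply Rabs_right, Rle_ge.
Qed.

Lemma ex_series_exp x : ex_series (fun n => x ^ n / INR (fact n)).
Proof.
assert (E : ex_pseries (fun n => / INR (fact n)) x) by (exists (exp x); apply is_exp_Reals).
eapply ex_series_ext; [|exact (proj1 (ex_pseries_R _ x) E)].
intro n. unfold Rdiv. apply Rmult_comm.
Qed.

Lemma CV_radius_signed e : newton_decay e -> CV_radius (signed e) = p_infty.
Proof.
intro H. apply CV_radius_p_infty. intros x Hx.
apply (@ex_series_le R_AbsRing R_CompleteNormedModule) with
  (fun n => (e 1%nat * x) ^ n / INR (fact n)); [|apply ex_series_exp].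
intro n. unfold norm; simpl. unfold abs; simpl. rewrite Rabs_Rabsolu.
assert (Hp := decay_pos e H n).
rewrite Rabs_mult, Rabs_signed, Rabs_right by (try apply Rle_ge; try apply pow_le; lra).
rewrite Rpow_mult_distr. assert (B := decay_fact e n H).
assert (0 <= x ^ n) by (apply pow_le; lra).
apply Rle_trans with (e 1%nat ^ n / INR (fact n) * x ^ n); [now apply Rmult_le_compat_r|].
right. unfold Rdiv. ring.
Qed.

Lemma exp_half_lt_2 : exp (/ 2) < 2.
Proof.
assert (E : exp (/2) * exp (/2) = exp 1) by (rewrite <- exp_plus; f_equal; lra).
assert (H := exp_le_3). assert (P := exp_pos (/2)). nra.
Qed.

(** On this disc the series is 1 plus a remainder of modulus at most
    [exp (1/2) - 1 < 1]. *)
Lemma CPSeries_signed_neq_0 e (x : C) :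
  newton_decay e -> Cmod x <= / (2 * e 1%nat) -> CPSeries (signed e) x <> RtoC 0.
Proof.
intros H Hx E. assert (He := decay_pos e H 1%nat).
set (v := fun n => (signed e n * Cpow x n)%C).
assert (Hv : Csummable v) by (apply CPSeries_summable; now rewrite CV_radius_signed).
assert (Hw : Csummable (fun n => v (S n))).
{ unfold Csummable. now apply (ex_series_incr_1 (fun n => Cmod (v n))). }
assert (B : Cmod (CSeries (fun n => v (S n))) <= exp (/ 2) - 1).
{ eapply Rle_trans; [apply Cmod_CSeries, Hw|].
  apply Rle_trans with (Series (fun n => (/2) ^ S n / INR (fact (S n)))).
  - apply Series_le.
    2:{ apply (ex_series_incr_1 (fun n => (/2) ^ n / INR (fact n))), ex_series_exp. }
    intro n. split; [apply Cmod_ge_0|]. unfold v.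
    rewrite Cmod_pterm, Rabs_mult, Rabs_signed by (left; apply H).
    assert (0 <= Cmod x ^ S n) by (apply pow_le, Cmod_ge_0).
    rewrite Rabs_right by now apply Rle_ge.
    assert (D := decay_fact e (S n) H).
    assert (Q : Cmod x ^ S n <= (/ (2 * e 1%nat)) ^ S n).
    { apply pow_incr. split; [apply Cmod_ge_0 | easy]. }
    assert (Hf := INR_fact_lt_0 (S n)).
    assert (F : 0 < e 1%nat ^ S n / INR (fact (S n))).
    { apply Rdiv_lt_0_compat; [now apply pow_lt | easy]. }
    apply Rle_trans with (e 1%nat ^ S n / INR (fact (S n)) * (/ (2 * e 1%nat)) ^ S n).
    + apply Rmult_le_compat; try easy. left; apply H.
    + right. rewrite Rinv_mult, Rpow_mult_distr, (pow_inv (e 1%nat)). field. split; [lra|].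
      apply pow_nonzero. lra.
  - right. assert (T := Series_incr_1 _ (ex_series_exp (/2))). cbv beta in T.
    assert (X : Series (fun n => (/ 2) ^ n / INR (fact n)) = exp (/2)).
    { rewrite exp_Reals. apply Series_ext. intro n. unfold Rdiv. apply Rmult_comm. }
    rewrite X in T. simpl (_ ^ 0) in T. simpl (INR (fact 0)) in T. lra. }
assert (T := CSeries_incr_1 v Hv). change (CSeries v) with (CPSeries (signed e) x) in T.
rewrite E in T.
assert (V0 : v O = RtoC 1).
{ unfold v, signed. simpl. rewrite (decay_0 e H), Rmult_1_l. ring. }
rewrite V0 in T.
assert (M : Cmod (CSeries (fun n => v (S n))) = 1).
{ rewrite <- Cmod_m1. f_equal.
  replace (CSeries (fun n => v (S n))) with ((1 + CSeries (fun n => v (S n))) - 1)%C by ring.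
  rewrite <- T. ring. }
assert (L := exp_half_lt_2). lra.
Qed.

(** * The generating series of the power sums *)

Definition power_sum_series (e : nat -> R) : R -> R := PSeries (newton_sum (signed e)).

(** After factoring out the variable the series still has nonnegative
    coefficients, with the positive constant term [e 1]. *)
Lemma power_sum_series_incr e s t :
  newton_decay e -> 0 <= s < t -> t < / e 1%nat ->
  power_sum_series e s < power_sum_series e t.
Proof.
intros H Hst Ht. unfold power_sum_series. set (p := newton_sum (signed e)).
assert (He := decay_pos e H 1%nat).
assert (Rt : Rbar_lt t (CV_radius p)) by now apply CV_radius_newton_sum.
assert (Rs : Rbar_lt s (CV_radius p)) by (apply CV_radius_newton_sum; [easy | lra]).
rewrite (PSeries_split p s), (PSeries_split p t) by (try easy; lra).
assert (N : forall n, 0 <= PS_decr_1 p n) by (intro; now apply newton_sum_nonneg).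
assert (B := PSeries_le_nonneg (PS_decr_1 p) s t N ltac:(lra)).
rewrite CV_radius_decr_1 in B. specialize (B Rt).
assert (B1 := PSeries_nonneg_ge (PS_decr_1 p) t N ltac:(lra)).
rewrite CV_radius_decr_1 in B1. specialize (B1 Rt).
assert (P1 : PS_decr_1 p O = e 1%nat) by (apply newton_sum_1, H).
rewrite P1 in B1. nra.
Qed.

Lemma power_sum_series_0 e : power_sum_series e 0 = 0.
Proof. unfold power_sum_series. rewrite PSeries_0. apply newton_sum_0. Qed.

(** The first power sum alone contributes [1/2] at this point, and the second is
    positive. So the values needed for the radii are all attained where the
    power sums converge and the original series has no zero. *)
Lemma power_sum_series_half e :
  newton_decay e -> / 2 < power_sum_series e (/ (2 * e 1%nat)).
Proof.
intros H. unfold power_sum_series. set (p := newton_sum (signed e)).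
assert (He := decay_pos e H 1%nat). set (t := / (2 * e 1%nat)).
assert (Ht0 : 0 < t) by (apply Rinv_0_lt_compat; lra).
assert (Ht : t < / e 1%nat) by (apply Rinv_lt_contravar; nra).
assert (Rt : Rbar_lt t (CV_radius p)) by now apply CV_radius_newton_sum.
assert (Hp0 : p O = 0) by apply newton_sum_0.
assert (Hp1 : p 1%nat = e 1%nat) by apply newton_sum_1, H.
assert (Hp2 : 0 < p 2%nat) by now apply newton_sum_bounds.
assert (E : t * e 1%nat = / 2) by (unfold t; field; lra).
rewrite (PSeries_split p t) by (try easy; lra).
rewrite (PSeries_split (PS_decr_1 p) t) by (try lra; now rewrite CV_radius_decr_1).
assert (B := PSeries_nonneg_ge (PS_decr_1 (PS_decr_1 p)) t).
rewrite 2!CV_radius_decr_1 in B.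
assert (B' := B ltac:(intro; now apply newton_sum_nonneg) ltac:(lra) Rt).
change (p 2%nat <= PSeries (PS_decr_1 (PS_decr_1 p)) t) in B'.
change (PS_decr_1 p O) with (p 1%nat). rewrite Hp0, Hp1.
rewrite Rmult_plus_distr_l, E.
assert (0 < t * (t * PSeries (PS_decr_1 (PS_decr_1 p)) t)); [|lra].
apply Rmult_lt_0_compat; [easy|]. apply Rmult_lt_0_compat; lra.
Qed.

Lemma power_sum_series_solve e v :
  newton_decay e -> 0 < v <= / 2 ->
  exists t, 0 < t < / (2 * e 1%nat) /\ power_sum_series e t = v.
Proof.
intros H Hv. assert (He := decay_pos e H 1%nat). set (T := / (2 * e 1%nat)).
assert (HT0 : 0 < T) by (apply Rinv_0_lt_compat; lra).
assert (HT : T < / e 1%nat) by (apply Rinv_lt_contravar; nra).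
assert (Hc : forall x, 0 <= x <= T -> continuity_pt (power_sum_series e) x).
{ intros x Hx. apply PSeries_continuity. rewrite Rabs_right by lra.
  apply CV_radius_newton_sum; [easy | lra]. }
destruct (IVT_Rbar_incr (power_sum_series e) 0 T (power_sum_series e 0)
   (power_sum_series e T) v) as [t [H1 [H2 H3]]].
- apply is_lim_continuity, Hc. lra.
- apply is_lim_continuity, Hc. lra.
- intros x H1 H2. simpl in H1, H2. apply Hc. lra.
- exact HT0.
- assert (B := power_sum_series_half e H). fold T in B. rewrite power_sum_series_0.
  simpl. lra.
- exists t. simpl in H1, H2. tauto.
Qed.

(** Newton's identities, summed by the Cauchy product. *)
Lemma CPSeries_log_derivative e (x : C) :
  newton_decay e -> Cmod x < / e 1%nat ->
  CPSeries (fun n => INR n * signed e n) x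
  = (- (CPSeries (signed e) x * CPSeries (newton_sum (signed e)) x))%C.
Proof.
intros H Hx.
assert (R : CV_radius (signed e) = p_infty) by now apply CV_radius_signed.
assert (Rx : Rbar_lt (Cmod x) (CV_radius (newton_sum (signed e)))) by now apply CV_radius_newton_sum.
rewrite <- CPSeries_mult by (try easy; now rewrite R).
assert (Hc : signed e O = 1) by (unfold signed; rewrite (decay_0 e H); simpl; ring).
transitivity (CPSeries (fun n => -1 * PS_mult (signed e) (newton_sum (signed e)) n) x).
- apply CPSeries_ext. intro n. rewrite newton_identity by easy. ring.
- rewrite CPSeries_scal; [ring|].
  rewrite (CV_radius_ext _ (PS_opp (fun n => INR n * signed e n))).
  2:{ intro n. now rewrite newton_identity. }
  rewrite CV_radius_opp, <- CV_radius_decr_1.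
  rewrite (CV_radius_ext _ (PS_derive (signed e))) by easy.
  now rewrite CV_radius_derive, R.
Qed.

Lemma Cmod_newton_sum_le e (x : C) :
  newton_decay e -> Cmod x < / e 1%nat ->
  Cmod (CPSeries (newton_sum (signed e)) x) <= power_sum_series e (Cmod x).
Proof.
intros H Hx. eapply Rle_trans; [apply Cmod_CPSeries; now apply CV_radius_newton_sum|].
right. apply PSeries_ext. intro n. apply Rabs_right, Rle_ge. now apply newton_sum_nonneg.
Qed.

(** * The Taylor coefficients of the normalized Lommel function *)

(** The hypergeometric coefficients in the variable [z * z]:
    [(-1)^n / ((mu+2)(mu+3)...(mu+2n+1))]. *)
Definition lommel_even (mu : R) (n : nat) : R :=
  hyp1F2_coef 1 ((mu + 2) / 2) ((mu + 3) / 2) n * (-1/4) ^ n.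

Definition lommel_coef (mu : R) (n : nat) : R :=
  if Nat.even n then 0 else lommel_even mu (Nat.div2 n).

(** The derivative of [lommel_g mu], as a series in [z * z], has the coefficients
    [(-1)^n * lommel_moduli mu n]. *)
Definition lommel_moduli (mu : R) (n : nat) : R :=
  INR (2 * n + 1) * Rabs (lommel_even mu n).

Lemma pochhammer_pos a n : 0 < a -> 0 < pochhammer a n.
Proof.
intro Ha. induction n as [|n IH]; simpl; [lra|].
apply Rmult_lt_0_compat; [easy|]. assert (T := pos_INR n). lra.
Qed.

Lemma lommel_even_S mu n :
  -1 < mu ->
  lommel_even mu (S n)
  = - lommel_even mu n / ((mu + 2 + 2 * INR n) * (mu + 3 + 2 * INR n)).
Proof.
intro Hm. assert (T := pos_INR n). unfold lommel_even, hyp1F2_coef. cbn [pochhammer pow].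
rewrite fact_simpl, mult_INR, S_INR.
assert (Hb := pochhammer_pos ((mu + 2) / 2) n ltac:(lra)).
assert (Hc := pochhammer_pos ((mu + 3) / 2) n ltac:(lra)).
assert (Hf := INR_fact_lt_0 n).
field. repeat split; lra.
Qed.

Lemma lommel_even_0 mu : lommel_even mu 0 = 1.
Proof. unfold lommel_even, hyp1F2_coef. simpl. field. Qed.

Lemma lommel_even_signed mu n : -1 < mu -> lommel_even mu n = (-1) ^ n * Rabs (lommel_even mu n).
Proof.
intro Hm. induction n as [|n IH].
- rewrite lommel_even_0, Rabs_R1. simpl. ring.
- rewrite lommel_even_S by easy. assert (T := pos_INR n).
  set (d := (mu + 2 + 2 * INR n) * (mu + 3 + 2 * INR n)).
  assert (Hd : 0 < d) by (apply Rmult_lt_0_compat; lra).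
  rewrite Rabs_div by lra. rewrite Rabs_Ropp, (Rabs_right d) by lra.
  rewrite IH at 1. simpl. field. lra.
Qed.

Lemma lommel_even_neq_0 mu n : -1 < mu -> lommel_even mu n <> 0.
Proof.
intro Hm. induction n as [|n IH].
- rewrite lommel_even_0. lra.
- rewrite lommel_even_S by easy. assert (T := pos_INR n).
  intro E. apply IH. apply Rmult_integral in E. destruct E as [E|E]; [lra|exfalso].
  revert E. apply Rinv_neq_0_compat. apply Rgt_not_eq, Rmult_lt_0_compat; lra.
Qed.

Lemma lommel_moduli_S mu n :
  -1 < mu ->
  lommel_moduli mu (S n) * ((2 * INR n + 1) * ((mu + 2 + 2 * INR n) * (mu + 3 + 2 * INR n)))
  = (2 * INR n + 3) * lommel_moduli mu n.
Proof.
intro Hm. assert (T := pos_INR n). unfold lommel_moduli. rewrite lommel_even_S by easy.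
set (d := (mu + 2 + 2 * INR n) * (mu + 3 + 2 * INR n)).
assert (Hd : 0 < d) by (apply Rmult_lt_0_compat; lra).
rewrite Rabs_div by lra. rewrite Rabs_Ropp, (Rabs_right d) by lra.
rewrite !plus_INR, !mult_INR, (S_INR n). simpl (INR 2). simpl (INR 1). field. lra.
Qed.

(** The ratio of consecutive moduli is explicit, so both conditions become
    polynomial inequalities in [mu] and [n]. The quotient [e 1 * e 1 / e 2]
    decreases in [mu] and is still [9/2] at [mu = 1], which leaves room for
    [decay_2]. *)
Lemma lommel_moduli_decay mu : -1 < mu < 1 -> newton_decay (lommel_moduli mu).
Proof.
intros Hm.
assert (E0 : lommel_moduli mu 0 = 1).
{ unfold lommel_moduli. rewrite lommel_even_0, Rabs_R1. simpl. ring. }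
assert (Ep : forall n, 0 < lommel_moduli mu n).
{ intro n. apply Rmult_lt_0_compat; [apply lt_0_INR; lia|].
  apply Rabs_pos_lt, lommel_even_neq_0, Hm. }
assert (E1 := lommel_moduli_S mu 0 ltac:(lra)). simpl INR in E1. rewrite E0 in E1.
assert (E2 := lommel_moduli_S mu 1 ltac:(lra)). simpl INR in E2.
split; [easy | easy | |].
- intro n. assert (En := lommel_moduli_S mu n ltac:(lra)). assert (T := pos_INR n).
  rewrite S_INR. set (x := INR n) in *.
  set (A := (mu + 2) * (mu + 3)). set (D := (mu + 2 + 2 * x) * (mu + 3 + 2 * x)) in *.
  assert (HA : 0 < A) by (apply Rmult_lt_0_compat; lra).
  assert (HD : 0 < D) by (apply Rmult_lt_0_compat; lra).
  assert (F1 : lommel_moduli mu 1 * A = 3) by (unfold A; nra).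
  assert (K : (x + 1) * (2 * x + 3) * A <= 3 * (2 * x + 1) * D).
  { (* the two factors of [A] are compared with those of [D] one at a time *)
    assert (K1 : (mu + 2) * (2 * x + 3) <= 3 * (mu + 2 + 2 * x)) by nra.
    assert (K3 : (mu + 3) * (x + 1) <= (2 * x + 1) * (mu + 3 + 2 * x)) by nra.
    unfold A, D.
    apply Rle_trans with ((3 * (mu + 2 + 2 * x)) * ((2 * x + 1) * (mu + 3 + 2 * x))); [|lra].
    replace ((x + 1) * (2 * x + 3) * ((mu + 2) * (mu + 3)))
      with ((mu + 2) * (2 * x + 3) * ((mu + 3) * (x + 1))) by ring.
    apply Rmult_le_compat; try easy; apply Rmult_le_pos; lra. }
  assert (P := Ep n).
  apply Rmult_le_reg_r with (A * ((2 * x + 1) * D)).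
  { apply Rmult_lt_0_compat; [easy|]. apply Rmult_lt_0_compat; lra. }
  replace ((x + 1) * lommel_moduli mu (S n) * (A * ((2 * x + 1) * D)))
    with ((x + 1) * A * (lommel_moduli mu (S n) * ((2 * x + 1) * D))) by ring.
  rewrite En.
  replace (lommel_moduli mu 1 * lommel_moduli mu n * (A * ((2 * x + 1) * D)))
    with ((lommel_moduli mu 1 * A) * (2 * x + 1) * D * lommel_moduli mu n) by ring.
  rewrite F1.
  replace ((x + 1) * A * ((2 * x + 3) * lommel_moduli mu n))
    with ((x + 1) * (2 * x + 3) * A * lommel_moduli mu n) by ring.
  apply Rmult_le_compat_r; [lra | exact K].
- set (a := lommel_moduli mu 1) in *. set (b := lommel_moduli mu 2) in *.
  assert (Ha := Ep 1%nat). fold a in Ha.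
  set (A := (mu + 2) * (mu + 3)). set (D := (mu + 4) * (mu + 5)).
  assert (HA : 0 < A) by (apply Rmult_lt_0_compat; lra).
  assert (HD : 0 < D) by (apply Rmult_lt_0_compat; lra).
  assert (F1 : a * A = 3) by (unfold A; nra).
  assert (F2 : 3 * (b * D) = 5 * a) by (unfold D; nra).
  assert (K : 20 * A <= 9 * D) by (unfold A, D; nra).
  apply Rmult_le_reg_r with (3 * D); [lra|].
  replace (4 * b * (3 * D)) with (4 * (3 * (b * D))) by ring. rewrite F2.
  replace (a * a * (3 * D)) with (a * (a * (3 * D))) by ring.
  replace (4 * (5 * a)) with (a * 20) by ring.
  apply Rmult_le_compat_l; [lra|].
  apply Rmult_le_reg_r with A; [easy|].
  replace (a * (3 * D) * A) with ((a * A) * (3 * D)) by ring. rewrite F1. lra.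
Qed.

Lemma signed_lommel_moduli mu n :
  -1 < mu -> signed (lommel_moduli mu) n = INR (2 * n + 1) * lommel_even mu n.
Proof.
intro Hm. unfold signed, lommel_moduli. rewrite (lommel_even_signed mu n) at 2 by easy. ring.
Qed.

Lemma lommel_coef_even mu n : lommel_coef mu (2 * n) = 0.
Proof. unfold lommel_coef. now rewrite Nat.even_mul. Qed.

Lemma lommel_coef_odd mu n : lommel_coef mu (2 * n + 1) = lommel_even mu n.
Proof.
unfold lommel_coef. rewrite Nat.even_add, Nat.even_mul. cbn [Nat.even orb Bool.eqb].
f_equal. rewrite Nat.add_1_r. apply Nat.div2_succ_double.
Qed.

Lemma CV_radius_lommel_even mu : -1 < mu < 1 -> CV_radius (lommel_even mu) = p_infty.
Proof.
intro Hm. apply CV_radius_p_infty_le with (signed (lommel_moduli mu)).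
- intro n. rewrite signed_lommel_moduli, Rabs_mult by lra.
  assert (T := Rabs_pos (lommel_even mu n)).
  assert (1 <= Rabs (INR (2 * n + 1))); [|nra].
  rewrite Rabs_right by apply Rle_ge, pos_INR. apply (le_INR 1). lia.
- now apply CV_radius_signed, lommel_moduli_decay.
Qed.

Lemma CV_radius_lommel_coef mu : -1 < mu < 1 -> CV_radius (lommel_coef mu) = p_infty.
Proof.
intro Hm. apply CV_radius_p_infty. intros x Hx.
assert (Z : ex_series (fun n => 0 * (/ 2) ^ n)).
{ apply (@ex_series_scal_l R_AbsRing R_NormedModule 0 (fun n => (/2) ^ n)).
  apply ex_series_geom. rewrite Rabs_right; lra. }
eexists. apply is_series_odd_even.
- eapply is_series_ext; [|exact (Series_correct _ Z)].
  intro n. cbv beta. now rewrite lommel_coef_even, !Rmult_0_l, Rabs_R0.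
- apply is_series_ext with (fun n => x * Rabs (lommel_even mu n * (x ^ 2) ^ n)).
  + intro n. rewrite lommel_coef_odd, <- pow_mult, pow_add, pow_1, !Rabs_mult, (Rabs_right x) by lra.
    rewrite Rmult_comm, Rmult_assoc. reflexivity.
  + apply (@is_series_scal_l R_AbsRing R_NormedModule), Series_correct.
    apply CV_disk_inside. now rewrite CV_radius_lommel_even.
Qed.

Lemma lommel_g_CPSeries mu : -1 < mu < 1 -> lommel_g mu = CPSeries (lommel_coef mu).
Proof.
intro Hm. apply functional_extensionality. intro z.
rewrite CPSeries_odd_even.
- rewrite CPSeries_zero by apply lommel_coef_even. rewrite Cplus_0_l.
  unfold lommel_g, Chyp1F2. f_equal. apply CPSeries_ext_terms. intro n.
  rewrite lommel_coef_odd. unfold lommel_even.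
  replace (- (z * z) / RtoC 4)%C with (RtoC (-1/4) * (z * z))%C.
  2:{ rewrite RtoC_div by lra. field. }
  rewrite Cpow_mult_l, RtoC_mult, <- RtoC_pow. ring.
- apply Csummable_zero, lommel_coef_even.
- eapply ex_series_ext; [|apply (Csummable_entire (lommel_even mu) (z * z)), CV_radius_lommel_even, Hm].
  intro n. cbv beta. now rewrite lommel_coef_odd.
Qed.

Lemma derive_lommel_coef_even mu n :
  -1 < mu -> PS_derive (lommel_coef mu) (2 * n) = signed (lommel_moduli mu) n.
Proof.
intro Hm. unfold PS_derive. rewrite signed_lommel_moduli by easy.
replace (S (2 * n)) with (2 * n + 1)%nat by lia. now rewrite lommel_coef_odd.
Qed.

Lemma derive_lommel_coef_odd mu n : PS_derive (lommel_coef mu) (2 * n + 1) = 0.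
Proof.
unfold PS_derive. replace (S (2 * n + 1)) with (2 * S n)%nat by lia.
rewrite lommel_coef_even. ring.
Qed.

Lemma CPSeries_derive_lommel mu (z : C) :
  -1 < mu < 1 ->
  CPSeries (PS_derive (lommel_coef mu)) z = CPSeries (signed (lommel_moduli mu)) (z * z)%C.
Proof.
intro Hm.
assert (Hs : Csummable (fun n => (signed (lommel_moduli mu) n * Cpow (z * z) n)%C)).
{ apply Csummable_entire, CV_radius_signed, lommel_moduli_decay, Hm. }
rewrite CPSeries_odd_even.
- rewrite (CPSeries_zero (fun n => PS_derive _ (2 * n + 1))) by apply derive_lommel_coef_odd.
  rewrite Cmult_0_r, Cplus_0_r. apply CPSeries_ext. intro n.
  apply derive_lommel_coef_even. lra.
- eapply ex_series_ext; [|exact Hs]. intro n. cbv beta. now rewrite derive_lommel_coef_even by lra.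
- apply Csummable_zero, derive_lommel_coef_odd.
Qed.

Lemma CPSeries_derive2_lommel mu (z : C) :
  -1 < mu < 1 ->
  (z * CPSeries (PS_derive (PS_derive (lommel_coef mu))) z
   = RtoC 2 * CPSeries (fun n => INR n * signed (lommel_moduli mu) n)%R (z * z))%C.
Proof.
intro Hm. set (s := signed (lommel_moduli mu)).
assert (Rs : CV_radius s = p_infty) by apply CV_radius_signed, lommel_moduli_decay, Hm.
assert (Rd : CV_radius (PS_derive s) = p_infty) by now rewrite CV_radius_derive.
set (d := PS_derive (PS_derive (lommel_coef mu))).
assert (De : forall n, d (2 * n)%nat = 0).
{ intro n. unfold d. unfold PS_derive at 1.
  replace (S (2 * n)) with (2 * n + 1)%nat by lia. rewrite derive_lommel_coef_odd. ring. }
assert (Do : forall n, d (2 * n + 1)%nat = 2 * PS_derive s n).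
{ intro n. unfold d. unfold PS_derive at 1.
  replace (S (2 * n + 1)) with (2 * S n)%nat by lia. rewrite derive_lommel_coef_even by lra.
  unfold PS_derive. fold s. rewrite mult_INR. simpl (INR 2). ring. }
rewrite CPSeries_odd_even.
- rewrite CPSeries_zero, Cplus_0_l by easy.
  rewrite (CPSeries_ext _ (fun n => 2 * PS_derive s n)) by easy.
  rewrite CPSeries_scal by now rewrite Rd.
  assert (X : CPSeries (fun n => INR n * s n)%R (z * z)%C
     = ((z * z) * CPSeries (PS_derive s) (z * z))%C); [|rewrite X; ring].
  change (CPSeries (PS_derive s) (z * z))%C with (CSeries (fun n => (PS_derive s n * Cpow (z * z) n)%C)).
  rewrite <- CSeries_scal by now apply Csummable_entire.
  assert (Hn : Csummable (fun n => (RtoC (INR n * s n)%R * Cpow (z * z) n)%C)).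
  { apply (Csummable_entire (fun n => INR n * s n)). rewrite <- CV_radius_decr_1. exact Rd. }
  change (CPSeries (fun n => INR n * s n)%R (z * z))%C
    with (CSeries (fun n => (RtoC (INR n * s n)%R * Cpow (z * z) n)%C)).
  rewrite CSeries_incr_1 by exact Hn. simpl (INR 0). rewrite Rmult_0_l, Cmult_0_l, Cplus_0_l.
  apply CSeries_ext. intro n. unfold PS_derive. rewrite Cpow_S. ring.
- now apply Csummable_zero.
- eapply ex_series_ext; [|exact (Csummable_scal (RtoC 2) _ (Csummable_entire _ (z * z)%C Rd))].
  intro n. cbv beta. rewrite Do, RtoC_mult, Cmult_assoc. reflexivity.
Qed.

(** * The radii of convexity *)

Definition lommel_power_sums (mu : R) : R -> R := power_sum_series (lommel_moduli mu).

(** The square of a radius inside which the derivative has no zero and both radii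
    of convexity lie. *)
Definition lommel_sqr_bound (mu : R) : R := / (2 * lommel_moduli mu 1).

Lemma C_derive_lommel_g mu :
  -1 < mu < 1 -> C_derive (lommel_g mu) = CPSeries (PS_derive (lommel_coef mu)).
Proof.
intro Hm. apply functional_extensionality. intro z. rewrite lommel_g_CPSeries by easy.
now apply C_derive_CPSeries, CV_radius_lommel_coef.
Qed.

Lemma C_derive2_lommel_g mu :
  -1 < mu < 1 ->
  C_derive_n 2 (lommel_g mu) = CPSeries (PS_derive (PS_derive (lommel_coef mu))).
Proof.
intro Hm. apply functional_extensionality. intro z.
change (C_derive (C_derive (lommel_g mu)) z = CPSeries (PS_derive (PS_derive (lommel_coef mu))) z).
rewrite C_derive_lommel_g by easy. apply C_derive_CPSeries.
now rewrite CV_radius_derive, CV_radius_lommel_coef.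
Qed.

Lemma C_derive_lommel_g_neq_0 mu (z : C) :
  -1 < mu < 1 -> Cmod z * Cmod z <= lommel_sqr_bound mu -> C_derive (lommel_g mu) z <> RtoC 0.
Proof.
intros Hm Hz. rewrite C_derive_lommel_g, CPSeries_derive_lommel by easy.
apply CPSeries_signed_neq_0; [now apply lommel_moduli_decay | now rewrite Cmod_mult].
Qed.

Lemma lommel_sqr_bound_lt mu : -1 < mu < 1 -> 0 < lommel_sqr_bound mu < / lommel_moduli mu 1.
Proof.
intro Hm. assert (H := decay_pos _ (lommel_moduli_decay mu Hm) 1%nat). unfold lommel_sqr_bound. split.
- apply Rinv_0_lt_compat. lra.
- apply Rinv_lt_contravar; nra.
Qed.

(** [z f''/f'] is twice the logarithmic derivative of the derivative with respect
    to [z * z]. *)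
Lemma zf2_f1_lommel_g mu (z : C) :
  -1 < mu < 1 -> Cmod z * Cmod z <= lommel_sqr_bound mu ->
  zf2_f1 (lommel_g mu) z
  = (RtoC (-2) * CPSeries (newton_sum (signed (lommel_moduli mu))) (z * z))%C.
Proof.
intros Hm Hz. assert (N := C_derive_lommel_g_neq_0 mu z Hm Hz).
unfold zf2_f1. rewrite C_derive2_lommel_g, CPSeries_derive2_lommel by easy.
rewrite C_derive_lommel_g, CPSeries_derive_lommel in * by easy.
rewrite CPSeries_log_derivative.
- field. exact N.
- now apply lommel_moduli_decay.
- rewrite Cmod_mult. assert (T := lommel_sqr_bound_lt mu Hm). lra.
Qed.

Lemma Cmod_zf2_f1_le mu (z : C) :
  -1 < mu < 1 -> Cmod z * Cmod z <= lommel_sqr_bound mu ->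
  Cmod (zf2_f1 (lommel_g mu) z) <= 2 * lommel_power_sums mu (Cmod z * Cmod z).
Proof.
intros Hm Hz. rewrite zf2_f1_lommel_g, Cmod_mult, Cmod_R, <- Cmod_mult by easy.
replace (Rabs (-2)) with 2 by (rewrite Rabs_left; lra).
apply Rmult_le_compat_l; [lra|]. apply Cmod_newton_sum_le; [now apply lommel_moduli_decay|].
rewrite Cmod_mult. assert (T := lommel_sqr_bound_lt mu Hm). lra.
Qed.

Lemma zf2_f1_lommel_g_real mu (x : R) :
  -1 < mu < 1 -> x * x <= lommel_sqr_bound mu ->
  zf2_f1 (lommel_g mu) (RtoC x) = RtoC (-2 * lommel_power_sums mu (x * x)).
Proof.
intros Hm Hx. rewrite zf2_f1_lommel_g.
- rewrite <- RtoC_mult, CPSeries_RtoC, <- RtoC_mult. reflexivity.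
- easy.
- rewrite Cmod_R, <- Rabs_mult, Rabs_right; [easy|]. apply Rle_ge. nra.
Qed.

(** The power sums are nonnegative, so [|w(z)| <= - w(|z|)] for [w = z f''/f'],
    and the positive axis is the worst direction. A condition that holds for
    [|w| < b] and fails at [w = - b] is therefore lost exactly where
    [w(r) = - b]. *)
Lemma radius_of_lommel_g mu (P : C -> Prop) (b r : R) :
  -1 < mu < 1 -> 0 < r -> r * r < lommel_sqr_bound mu -> 2 * lommel_power_sums mu (r * r) = b ->
  (forall w, Cmod w < b -> P w) -> ~ P (RtoC (- b)) ->
  radius_of P (lommel_g mu) = Finite r.
Proof.
intros Hm Hr HT Hb HP HN. apply is_lub_Rbar_unique. split.
- intros r' [H1 [_ H3]]. simpl. destruct (Rle_or_lt r' r) as [|L]; [easy|exfalso].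
  apply HN. destruct (H3 (RtoC r)) as [_ Q].
  { rewrite Cmod_R, Rabs_right; lra. }
  rewrite zf2_f1_lommel_g_real in Q by (try easy; lra).
  now replace (- b) with (-2 * lommel_power_sums mu (r * r)) by lra.
- intros l Hl. apply Hl. split; [easy|]. split.
  + rewrite lommel_g_CPSeries, convergence_radius_CPSeries; [exact I | | easy].
    now apply CV_radius_lommel_coef.
  + intros z Hz. assert (Z := Cmod_ge_0 z).
    assert (Q : Cmod z * Cmod z < r * r) by nra.
    split; [apply C_derive_lommel_g_neq_0; [easy | lra]|].
    apply HP. eapply Rle_lt_trans; [apply Cmod_zf2_f1_le; [easy | lra]|].
    assert (T := lommel_sqr_bound_lt mu Hm).
    rewrite <- Hb. apply Rmult_lt_compat_l; [lra|]. apply power_sum_series_incr.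
    * now apply lommel_moduli_decay.
    * split; [nra | easy].
    * lra.
Qed.

Lemma uniform_convexity_radius_lommel_g mu alpha beta r :
  -1 < mu < 1 -> alpha < 1 -> 0 <= beta ->
  0 < r -> r * r < lommel_sqr_bound mu -> 2 * lommel_power_sums mu (r * r) = (1 - alpha) / (1 + beta) ->
  uniform_convexity_radius beta alpha (lommel_g mu) = Finite r.
Proof.
intros Hm Ha Hb Hr HT HW.
assert (E : (1 - alpha) / (1 + beta) * (1 + beta) = 1 - alpha) by (field; lra).
assert (E0 : 0 < (1 - alpha) / (1 + beta)) by (apply Rdiv_lt_0_compat; lra).
apply (radius_of_lommel_g mu _ _ r Hm Hr HT HW).
- intros w Hw. assert (B := re_le_Cmod w).
  assert (B' := Rle_abs (- Re w)). rewrite Rabs_Ropp in B'.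
  change (1 + Re w > beta * Cmod w + alpha). nra.
- rewrite Cmod_R, Rabs_Ropp, Rabs_right by lra.
  change (~ (1 + - ((1 - alpha) / (1 + beta)) > beta * ((1 - alpha) / (1 + beta)) + alpha)). nra.
Qed.

Lemma convexity_radius_lommel_g mu r :
  -1 < mu < 1 -> 0 < r -> r * r < lommel_sqr_bound mu -> 2 * lommel_power_sums mu (r * r) = 1 ->
  convexity_radius (lommel_g mu) = Finite r.
Proof.
intros Hm Hr HT HW. apply (radius_of_lommel_g mu _ _ r Hm Hr HT HW).
- intros w Hw. assert (B := re_le_Cmod w).
  assert (B' := Rle_abs (- Re w)). rewrite Rabs_Ropp in B'.
  change (1 + Re w > 0). lra.
- change (~ (1 + - 1 > 0)). lra.
Qed.

(** * The differential equation and a negative value *)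

(** The restrictions to the real line of [lommel_g mu] and its first two
    derivatives. *)
Definition gR mu : R -> R := PSeries (lommel_coef mu).

Definition dgR mu : R -> R := PSeries (PS_derive (lommel_coef mu)).

Definition ddgR mu : R -> R := PSeries (PS_derive (PS_derive (lommel_coef mu))).

Lemma is_derive_gR mu x : -1 < mu < 1 -> is_derive (gR mu) x (dgR mu x).
Proof. intro Hm. apply is_derive_PSeries. now rewrite CV_radius_lommel_coef. Qed.

Lemma is_derive_dgR mu x : -1 < mu < 1 -> is_derive (dgR mu) x (ddgR mu x).
Proof. intro Hm. apply is_derive_PSeries. now rewrite CV_radius_derive, CV_radius_lommel_coef. Qed.

Lemma lommel_coef_0 mu : lommel_coef mu 0 = 0.
Proof. reflexivity. Qed.

Lemma lommel_coef_1 mu : lommel_coef mu 1 = 1.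
Proof. exact (eq_trans (lommel_coef_odd mu 0) (lommel_even_0 mu)). Qed.

Lemma lommel_coef_SS mu n :
  -1 < mu ->
  (INR n + 2 + mu) * (INR n + 1 + mu) * lommel_coef mu (S (S n)) = - lommel_coef mu n.
Proof.
intro Hm. destruct (Nat.Even_or_Odd n) as [[m ->]|[m ->]].
- replace (S (S (2 * m))) with (2 * S m)%nat by lia. rewrite !lommel_coef_even. ring.
- replace (S (S (2 * m + 1))) with (2 * S m + 1)%nat by lia.
  rewrite !lommel_coef_odd, lommel_even_S by easy. assert (T := pos_INR m).
  rewrite plus_INR, mult_INR. simpl (INR 2). simpl (INR 1). field. lra.
Qed.

(** Multiplying the [n]-th coefficient by [(n + mu) (n + mu - 1)] shifts the
    series by two places up to sign; the coefficient of order 1 is left over and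
    gives the right-hand side. *)
Lemma lommel_ode mu x :
  -1 < mu < 1 ->
  x * x * ddgR mu x + 2 * mu * (x * dgR mu x) + mu * (mu - 1) * gR mu x + x * x * gR mu x
  = mu * (mu + 1) * x.
Proof.
intro Hm. set (a := lommel_coef mu).
assert (Ra : CV_radius a = p_infty) by now apply CV_radius_lommel_coef.
set (b1 := fun n => INR n * a n). set (b2 := fun n => INR n * (INR n - 1) * a n).
assert (D1 : forall n, PS_decr_1 b1 n = PS_derive a n) by reflexivity.
assert (D2 : forall n, PS_decr_1 (PS_decr_1 b2) n = PS_derive (PS_derive a) n).
{ intro n. change (INR (S (S n)) * (INR (S (S n)) - 1) * a (S (S n)) =
                   INR (S n) * (INR (S (S n)) * a (S (S n)))).
  rewrite !S_INR. ring. }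
assert (Rb1 : CV_radius b1 = p_infty).
{ now rewrite <- CV_radius_decr_1, (CV_radius_ext _ _ D1), CV_radius_derive. }
assert (Rb2 : CV_radius b2 = p_infty).
{ now rewrite <- CV_radius_decr_1, <- CV_radius_decr_1, (CV_radius_ext _ _ D2), !CV_radius_derive. }
assert (E1 : x * dgR mu x = PSeries b1 x).
{ rewrite (PSeries_entire_split b1 x Rb1), (PSeries_ext _ _ x D1).
  unfold b1, dgR. fold a. simpl INR. ring. }
assert (E2 : x * x * ddgR mu x = PSeries b2 x).
{ rewrite (PSeries_entire_split b2 x Rb2), (PSeries_entire_split (PS_decr_1 b2) x)
    by now rewrite CV_radius_decr_1.
  rewrite (PSeries_ext _ _ x D2). change (PS_decr_1 b2 O) with (b2 1%nat).
  unfold ddgR, b2. fold a. simpl INR. ring. }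
rewrite E1, E2. unfold gR. fold a.
set (q1 := fun n => 1 * b2 n + (2 * mu) * b1 n).
assert (Rq1 : CV_radius q1 = p_infty) by now apply CV_radius_linear.
set (q := fun n => 1 * q1 n + (mu * (mu - 1)) * a n).
assert (Rq : CV_radius q = p_infty) by now apply CV_radius_linear.
assert (E : PSeries q x = PSeries b2 x + 2 * mu * PSeries b1 x + mu * (mu - 1) * PSeries a x).
{ unfold q. rewrite PSeries_linear by easy. unfold q1. rewrite PSeries_linear by easy. ring. }
rewrite <- E.
assert (Q : forall n, q n = (INR n + mu) * (INR n + mu - 1) * a n).
{ intro n. unfold q, q1, b1, b2. ring. }
rewrite (PSeries_entire_split q x Rq), (PSeries_entire_split (PS_decr_1 q) x)
  by now rewrite CV_radius_decr_1.
rewrite (PSeries_ext (PS_decr_1 (PS_decr_1 q)) (fun n => -1 * a n + 0 * a n)).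
2:{ intro n. change (q (S (S n)) = -1 * a n + 0 * a n). rewrite Q, !S_INR.
    assert (T := lommel_coef_SS mu n ltac:(lra)). fold a in T.
    replace (INR n + 1 + 1 + mu) with (INR n + 2 + mu) by ring.
    replace (INR n + 2 + mu - 1) with (INR n + 1 + mu) by ring. rewrite T. ring. }
rewrite PSeries_linear by easy.
change (PS_decr_1 q O) with (q 1%nat). rewrite !Q. unfold a at 1 2.
rewrite lommel_coef_0, lommel_coef_1. simpl INR. ring.
Qed.

(** [x^mu g(x)] is, up to a constant factor, [sqrt x] times the Lommel function. It
    solves the forced oscillator [y'' + y = mu (mu + 1) x^(mu - 1)]. *)
Definition osc mu x := Rpower x mu * gR mu x.

Definition dosc mu x := mu * Rpower x (mu - 1) * gR mu x + Rpower x mu * dgR mu x.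

(** The Wronskian of [sin] and [osc]. Its derivative is the forcing term times
    [sin x], and at multiples of [PI] it is [osc] up to sign. *)
Definition lommel_wronskian mu x := dosc mu x * sin x - osc mu x * cos x.

Lemma is_derive_Rmult (f g : R -> R) (x df dg : R) :
  is_derive f x df -> is_derive g x dg ->
  is_derive (fun t => f t * g t) x (df * g x + f x * dg).
Proof. intros Hf Hg. exact (is_derive_mult f g x df dg Hf Hg Rmult_comm). Qed.

Lemma is_derive_Rpower (m x : R) :
  0 < x -> is_derive (fun t => Rpower t m) x (m * Rpower x (m - 1)).
Proof. intro Hx. apply is_derive_Reals. now apply derivable_pt_lim_power. Qed.

Lemma Rpower_minus1 x m : 0 < x -> Rpower x m = x * Rpower x (m - 1).
Proof.
intro Hx. rewrite <- (Rpower_1 x Hx) at 2. rewrite <- Rpower_plus. f_equal. ring.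
Qed.

Lemma is_derive_lommel_wronskian mu x :
  -1 < mu < 1 -> 0 < x ->
  is_derive (lommel_wronskian mu) x (mu * (mu + 1) * Rpower x (mu - 1) * sin x).
Proof.
intros Hm Hx.
assert (P1 := is_derive_Rpower mu x Hx). assert (P2 := is_derive_Rpower (mu - 1) x Hx).
assert (D0 := is_derive_gR mu x Hm). assert (D1 := is_derive_dgR mu x Hm).
assert (Dy : is_derive (osc mu) x (dosc mu x)).
{ exact (is_derive_Rmult _ _ _ _ _ P1 D0). }
set (y2 := mu * ((mu - 1) * Rpower x (mu - 1 - 1)) * gR mu x + mu * Rpower x (mu - 1) * dgR mu x
           + (mu * Rpower x (mu - 1) * dgR mu x + Rpower x mu * ddgR mu x)).
assert (Dy1 : is_derive (dosc mu) x y2).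
{ apply (@is_derive_plus R_AbsRing R_NormedModule).
  - exact (is_derive_Rmult _ _ _ _ _ (is_derive_scal _ _ mu _ P2) D0).
  - exact (is_derive_Rmult _ _ _ _ _ P1 D1). }
assert (Ds : is_derive sin x (cos x)) by (apply is_derive_Reals, derivable_pt_lim_sin).
assert (Dc : is_derive cos x (- sin x)) by (apply is_derive_Reals, derivable_pt_lim_cos).
assert (DE := @is_derive_minus R_AbsRing R_NormedModule _ _ _ _ _
   (is_derive_Rmult _ _ _ _ _ Dy1 Ds) (is_derive_Rmult _ _ _ _ _ Dy Dc)).
replace (mu * (mu + 1) * Rpower x (mu - 1) * sin x) with
  (y2 * sin x + dosc mu x * cos x - (dosc mu x * cos x + osc mu x * - sin x)).
- exact DE.
- assert (O := lommel_ode mu x Hm).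
  set (p := Rpower x (mu - 1 - 1)) in *.
  assert (Q1 : Rpower x (mu - 1) = x * p) by now apply Rpower_minus1.
  assert (Q0 : Rpower x mu = x * (x * p)) by now rewrite <- Q1; apply Rpower_minus1.
  unfold y2, osc, dosc. rewrite Q0, Q1.
  transitivity (p * sin x * (x * x * ddgR mu x + 2 * mu * (x * dgR mu x) +
    mu * (mu - 1) * gR mu x + x * x * gR mu x)); [ring|]. rewrite O. ring.
Qed.

(** The Wronskian tends to 0 at 0, although [osc] need not have a bounded derivative. *)
Lemma lommel_wronskian_small mu eps d :
  -1 < mu < 1 -> 0 < eps -> 0 < d ->
  exists x0, 0 < x0 < d /\ forall x, 0 < x <= x0 -> Rabs (lommel_wronskian mu x) <= eps.
Proof.
intros Hm He Hd. assert (Ra := CV_radius_lommel_coef mu Hm).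
destruct (PSeries_bounded (PS_decr_1 (lommel_coef mu))) as [B0 [HB0 K0]].
{ now rewrite CV_radius_decr_1. }
destruct (PSeries_bounded (PS_derive (lommel_coef mu))) as [B1 [HB1 K1]].
{ now rewrite CV_radius_derive. }
set (B := 2 * B0 + B1 + 1).
assert (HB : 0 < B) by (unfold B; lra).
(* both [sin x] and [gR mu x] are O(x), which compensates the factor x^(mu-1) *)
assert (K : forall x, 0 < x <= 1 -> Rabs (lommel_wronskian mu x) <= B * Rpower x (mu + 1)).
{ intros x Hx. specialize (K0 x ltac:(lra)). specialize (K1 x ltac:(lra)).
  set (F := PSeries (PS_decr_1 (lommel_coef mu)) x) in *.
  set (F1 := PSeries (PS_derive (lommel_coef mu)) x) in *.
  assert (EG : gR mu x = x * F).
  { unfold gR. rewrite PSeries_entire_split by easy. rewrite lommel_coef_0. fold F. ring. }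
  assert (Q1 : Rpower x mu = x * Rpower x (mu - 1)) by (apply Rpower_minus1; lra).
  assert (Q2 : Rpower x (mu + 1) = x * Rpower x mu).
  { replace mu with (mu + 1 - 1) at 2 by ring. apply Rpower_minus1; lra. }
  assert (Sx : 0 <= sin x <= x).
  { split; [apply sin_ge_0; assert (T := PI2_1); lra | left; apply sin_lt_x; lra]. }
  assert (Cx := COS_bound x).
  set (p := Rpower x mu) in *. assert (Hp : 0 < p) by apply exp_pos.
  assert (Q3 : mu * Rpower x (mu - 1) * gR mu x = mu * p * F) by (rewrite EG, Q1; ring).
  unfold lommel_wronskian, dosc, osc. rewrite Q3, Q2, EG. change (dgR mu x) with F1. fold p.
  replace ((mu * p * F + p * F1) * sin x - p * (x * F) * cos x)
    with (p * ((mu * F + F1) * sin x - x * F * cos x)) by ring.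
  rewrite Rabs_mult, (Rabs_right p) by lra.
  apply Rle_trans with (p * (x * B)); [|right; ring].
  apply Rmult_le_compat_l; [lra|].
  apply Rabs_le_between in K0. apply Rabs_le_between in K1.
  assert (A1 : Rabs (mu * F + F1) <= B0 + B1) by (apply Rabs_le; nra).
  assert (A2 : Rabs (x * F * cos x) <= x * B0).
  { rewrite !Rabs_mult, (Rabs_right x) by lra.
    assert (Rabs (cos x) <= 1) by (apply Rabs_le; lra).
    assert (Rabs F <= B0) by (apply Rabs_le; lra).
    assert (T0 := Rabs_pos F). assert (T1 := Rabs_pos (cos x)).
    rewrite Rmult_assoc. apply Rmult_le_compat_l; [lra|]. nra. }
  eapply Rle_trans; [apply Rabs_triang|]. rewrite Rabs_Ropp, Rabs_mult, (Rabs_right (sin x)) by lra.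
  assert (T0 := Rabs_pos (mu * F + F1)). unfold B. nra. }
(* [t] solves B t^(mu+1) = eps *)
set (t := Rpower (eps / B) (/ (mu + 1))).
assert (Ht : 0 < t) by apply exp_pos.
assert (Et : Rpower t (mu + 1) = eps / B).
{ unfold t. rewrite Rpower_mult, Rinv_l by lra. apply Rpower_1. now apply Rdiv_lt_0_compat. }
set (x0 := Rmin 1 (Rmin t (d / 2))).
assert (X1 : x0 <= 1) by apply Rmin_l.
assert (X2 : x0 <= t) by (eapply Rle_trans; [apply Rmin_r | apply Rmin_l]).
assert (X3 : x0 <= d / 2) by (eapply Rle_trans; [apply Rmin_r | apply Rmin_r]).
assert (X0 : 0 < x0) by (repeat apply Rmin_glb_lt; lra).
exists x0. split; [lra|]. intros x Hx. eapply Rle_trans; [apply K; lra|].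
apply Rle_trans with (B * Rpower t (mu + 1)).
- apply Rmult_le_compat_l; [lra|]. apply Rle_Rpower_l; lra.
- rewrite Et. right. field. lra.
Qed.

Lemma lommel_wronskian_MVT mu a b :
  -1 < mu < 1 -> 0 < a < b ->
  exists c, lommel_wronskian mu b - lommel_wronskian mu a
    = mu * (mu + 1) * Rpower c (mu - 1) * sin c * (b - a) /\ a < c < b.
Proof.
intros Hm Hab.
apply (MVT_cor2 (lommel_wronskian mu) (fun c => mu * (mu + 1) * Rpower c (mu - 1) * sin c)); [lra|].
intros c Hc. apply is_derive_Reals, is_derive_lommel_wronskian; lra.
Qed.

(** For negative [mu] the forcing term is negative, so the Wronskian decreases
    from 0 on the first half period. *)
Lemma gR_PI_neg mu : -1 < mu < 0 -> gR mu PI < 0.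
Proof.
intro Hm. assert (HPI := PI_RGT_0).
assert (Dec : forall a b, 0 < a < b -> b <= PI -> lommel_wronskian mu b < lommel_wronskian mu a).
{ intros a b Hab Hb. destruct (lommel_wronskian_MVT mu a b ltac:(lra) Hab) as [c [E Hc]].
  assert (S := sin_gt_0 c ltac:(lra) ltac:(lra)).
  assert (P : 0 < Rpower c (mu - 1)) by apply exp_pos.
  assert (0 < (- mu * (mu + 1)) * (Rpower c (mu - 1) * sin c) * (b - a)).
  { apply Rmult_lt_0_compat; [|lra]. apply Rmult_lt_0_compat; [nra|].
    now apply Rmult_lt_0_compat. }
  lra. }
assert (H1 : lommel_wronskian mu PI < lommel_wronskian mu (PI / 2)) by (apply Dec; lra).
assert (H2 : lommel_wronskian mu (PI / 2) <= 0).
{ destruct (Rle_or_lt (lommel_wronskian mu (PI / 2)) 0) as [|L]; [easy|exfalso].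
  destruct (lommel_wronskian_small mu (lommel_wronskian mu (PI / 2)) (PI / 2)) as [x [Hx Hs]]; try lra.
  specialize (Hs x ltac:(lra)). assert (D := Dec x (PI / 2) ltac:(lra) ltac:(lra)).
  assert (T := Rle_abs (lommel_wronskian mu x)). lra. }
assert (E : lommel_wronskian mu PI = Rpower PI mu * gR mu PI).
{ unfold lommel_wronskian, osc. rewrite sin_PI, cos_PI. ring. }
assert (P : 0 < Rpower PI mu) by apply exp_pos. nra.
Qed.

(** For positive [mu] the forcing term is positive and decreasing. Adding to the
    Wronskian its translate by [PI] leaves as derivative the forcing term minus
    its translate, times [sin], which is positive on the first half period.
    Comparing both ends gives a positive value at [2 * PI]. *)
Lemma gR_2PI_neg mu : 0 < mu < 1 -> gR mu (2 * PI) < 0.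
Proof.
intro Hm. assert (HPI := PI_RGT_0).
set (M := fun x => lommel_wronskian mu x + lommel_wronskian mu (x + PI)).
set (k := fun x => mu * (mu + 1) * Rpower x (mu - 1)).
assert (Inc : forall a b, 0 < a < b -> b <= PI -> M a < M b).
{ intros a b Hab Hb.
  destruct (MVT_cor2 M (fun c => (k c - k (c + PI)) * sin c) a b ltac:(lra)) as [c [E Hc]].
  { intros c Hc. apply is_derive_Reals.
    replace ((k c - k (c + PI)) * sin c) with (k c * sin c + 1 * (k (c + PI) * sin (c + PI)))
      by (rewrite neg_sin; ring).
    apply (@is_derive_plus R_AbsRing R_NormedModule).
    - apply is_derive_lommel_wronskian; lra.
    - apply (is_derive_comp (lommel_wronskian mu) (fun x => x + PI)).
      + apply is_derive_lommel_wronskian; lra.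
      + auto_derive; [easy | ring]. }
  assert (S := sin_gt_0 c ltac:(lra) ltac:(lra)).
  assert (P : Rpower (c + PI) (mu - 1) < Rpower c (mu - 1)).
  { unfold Rpower. apply exp_increasing.
    assert (ln c < ln (c + PI)) by (apply ln_increasing; lra). nra. }
  assert (0 < k c - k (c + PI)).
  { unfold k. rewrite <- Rmult_minus_distr_l. apply Rmult_lt_0_compat; [nra | lra]. }
  assert (0 < (k c - k (c + PI)) * sin c * (b - a)).
  { apply Rmult_lt_0_compat; [now apply Rmult_lt_0_compat | lra]. }
  lra. }
assert (H1 : M (PI / 2) < M PI) by (apply Inc; lra).
assert (H2 : lommel_wronskian mu PI <= M (PI / 2)).
{ destruct (Rle_or_lt (lommel_wronskian mu PI) (M (PI / 2))) as [|L]; [easy|exfalso].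
  set (g := lommel_wronskian mu PI - M (PI / 2)).
  assert (C : continuity_pt (lommel_wronskian mu) PI).
  { apply derivable_continuous_pt. eexists. apply is_derive_Reals, is_derive_lommel_wronskian; lra. }
  destruct (C (g / 3)) as [d [Hd HC]]; [unfold g; lra|].
  destruct (lommel_wronskian_small mu (g / 3) (Rmin d (PI / 2))) as [x [Hx Hs]];
    try (unfold g; lra). { apply Rmin_glb_lt; lra. }
  assert (X1 : x < d) by (eapply Rlt_le_trans; [apply Hx | apply Rmin_l]).
  assert (X2 : x < PI / 2) by (eapply Rlt_le_trans; [apply Hx | apply Rmin_r]).
  specialize (Hs x ltac:(lra)).
  assert (HC' : Rabs (lommel_wronskian mu (x + PI) - lommel_wronskian mu PI) < g / 3).
  { apply HC. split; [split; [exact I | lra]|].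
    change (Rabs (x + PI - PI) < d). replace (x + PI - PI) with x by ring.
    rewrite Rabs_right; lra. }
  assert (I1 := Inc x (PI / 2) ltac:(lra) ltac:(lra)). unfold M at 1 in I1.
  apply Rabs_le_between in Hs. apply Rabs_def2 in HC'. unfold g in *. lra. }
unfold M in H1 at 2. replace (PI + PI) with (2 * PI) in H1 by ring.
assert (E : lommel_wronskian mu (2 * PI) = - (Rpower (2 * PI) mu * gR mu (2 * PI))).
{ unfold lommel_wronskian, osc. rewrite sin_2PI, cos_2PI. ring. }
assert (P : 0 < Rpower (2 * PI) mu) by apply exp_pos. nra.
Qed.

Lemma gR_takes_negative_value mu : -1 < mu < 1 -> mu <> 0 -> exists X, 0 < X /\ gR mu X < 0.
Proof.
intros Hm H0. assert (HPI := PI_RGT_0). destruct (Rdichotomy _ _ H0) as [L|L].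
- exists PI. split; [easy|]. apply gR_PI_neg. lra.
- exists (2 * PI). split; [lra|]. apply gR_2PI_neg. lra.
Qed.

(** * The equation for the radius *)

Lemma lommel_half_gR mu x :
  -1 < mu < 1 -> mu <> 0 -> 0 < x ->
  lommel_half mu x = / (mu * (mu + 1)) * (Rpower x (mu - 1/2) * gR mu x).
Proof.
intros Hm H0 Hx.
assert (E := lommel_g_lommel_half mu x H0 ltac:(lra) Hx).
rewrite lommel_g_CPSeries, CPSeries_RtoC in E by easy.
assert (E' : gR mu x = mu * (mu + 1) * Rpower x (- mu + 1 / 2) * lommel_half mu x)
  by (injection E; easy).
rewrite E'.
assert (P : Rpower x (mu - 1/2) * Rpower x (- mu + 1/2) = 1).
{ rewrite <- Rpower_plus. replace (_ + _) with 0 by field. now apply Rpower_O. }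
transitivity ((Rpower x (mu - 1/2) * Rpower x (- mu + 1/2)) * lommel_half mu x);
  [rewrite P; ring | field; lra].
Qed.

Lemma locally_pos (x : R) (Q : R -> Prop) : 0 < x -> (forall t, 0 < t -> Q t) -> locally x Q.
Proof.
intros Hx H. exists (mkposreal x Hx). intros t Ht. apply H.
change (Rabs (t - x) < x) in Ht. apply Rabs_def2 in Ht. lra.
Qed.

Lemma is_derive_lommel_half mu x :
  -1 < mu < 1 -> mu <> 0 -> 0 < x ->
  is_derive (lommel_half mu) x
   (/ (mu * (mu + 1)) * ((mu - 1/2) * Rpower x (mu - 1/2 - 1) * gR mu x
                         + Rpower x (mu - 1/2) * dgR mu x)).
Proof.
intros Hm H0 Hx.
apply is_derive_ext_loc with (fun t => / (mu * (mu + 1)) * (Rpower t (mu - 1/2) * gR mu t)).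
{ apply locally_pos; [easy|]. intros t Ht. symmetry. now apply lommel_half_gR. }
apply is_derive_scal.
exact (is_derive_Rmult _ _ _ _ _ (is_derive_Rpower _ x Hx) (is_derive_gR mu x Hm)).
Qed.

Lemma Derive_n_2_lommel_half mu x :
  -1 < mu < 1 -> mu <> 0 -> 0 < x ->
  Derive_n (lommel_half mu) 2 x
  = / (mu * (mu + 1)) * ((mu - 1/2) * ((mu - 1/2 - 1) * Rpower x (mu - 1/2 - 1 - 1)) * gR mu x
     + 2 * ((mu - 1/2) * Rpower x (mu - 1/2 - 1) * dgR mu x) + Rpower x (mu - 1/2) * ddgR mu x).
Proof.
intros Hm H0 Hx. change (Derive (Derive (lommel_half mu)) x =
 / (mu * (mu + 1)) * ((mu - 1/2) * ((mu - 1/2 - 1) * Rpower x (mu - 1/2 - 1 - 1)) * gR mu x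
     + 2 * ((mu - 1/2) * Rpower x (mu - 1/2 - 1) * dgR mu x) + Rpower x (mu - 1/2) * ddgR mu x)).
apply is_derive_unique.
apply is_derive_ext_loc with (fun t => / (mu * (mu + 1)) *
  ((mu - 1/2) * Rpower t (mu - 1/2 - 1) * gR mu t + Rpower t (mu - 1/2) * dgR mu t)).
{ apply locally_pos; [easy|]. intros t Ht. symmetry. now apply is_derive_unique, is_derive_lommel_half. }
apply is_derive_scal.
replace (_ + _ + _) with
  (((mu - 1/2) * ((mu - 1/2 - 1) * Rpower x (mu - 1/2 - 1 - 1)) * gR mu x
     + (mu - 1/2) * Rpower x (mu - 1/2 - 1) * dgR mu x)
   + ((mu - 1/2) * Rpower x (mu - 1/2 - 1) * dgR mu x + Rpower x (mu - 1/2) * ddgR mu x)) by ring.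
assert (P1 := is_derive_Rpower (mu - 1/2) x Hx). assert (P2 := is_derive_Rpower (mu - 1/2 - 1) x Hx).
assert (D0 := is_derive_gR mu x Hm). assert (D1 := is_derive_dgR mu x Hm).
apply (@is_derive_plus R_AbsRing R_NormedModule).
- exact (is_derive_Rmult _ _ _ _ _ (is_derive_scal _ _ (mu - 1/2) _ P2) D0).
- exact (is_derive_Rmult _ _ _ _ _ P1 D1).
Qed.

(** The terms in [gR] cancel, leaving a multiple of the derivative of [lommel_g mu]. *)
Lemma uc_denominator_dgR mu x :
  -1 < mu < 1 -> mu <> 0 -> 0 < x ->
  uc_denominator mu x = / (mu * (mu + 1)) * (x * Rpower x (mu - 1/2)) * dgR mu x.
Proof.
intros Hm H0 Hx. unfold uc_denominator.
rewrite (is_derive_unique _ _ _ (is_derive_lommel_half mu x Hm H0 Hx)), lommel_half_gR by easy.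
rewrite (Rpower_minus1 x (mu - 1/2)) by easy. ring.
Qed.

Lemma uc_numerator_gR mu x :
  -1 < mu < 1 -> mu <> 0 -> 0 < x ->
  uc_numerator mu x
  = / (mu * (mu + 1)) * Rpower x (mu - 1/2) * ((mu + 1/2) * dgR mu x + x * ddgR mu x).
Proof.
intros Hm H0 Hx. unfold uc_numerator.
rewrite (is_derive_unique _ _ _ (is_derive_lommel_half mu x Hm H0 Hx)).
rewrite Derive_n_2_lommel_half by easy.
rewrite (Rpower_minus1 x (mu - 1/2)), (Rpower_minus1 x (mu - 1/2 - 1)) by easy. field. lra.
Qed.

(** The bracket in the equation is [- r g''(r) / g'(r)], hence twice the
    generating series of the power sums at [r * r]. *)
Lemma uc_equation_power_sums mu alpha beta x :
  -1 < mu < 1 -> mu <> 0 -> 0 < x -> x * x <= lommel_sqr_bound mu -> 0 <= beta ->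
  uc_equation mu alpha beta x <-> 2 * lommel_power_sums mu (x * x) = (1 - alpha) / (1 + beta).
Proof.
intros Hm H0 Hx HT Hb.
assert (N : dgR mu x <> 0).
{ intro E. apply (C_derive_lommel_g_neq_0 mu (RtoC x) Hm).
  - rewrite Cmod_R, <- Rabs_mult, Rabs_right; [easy | nra].
  - rewrite C_derive_lommel_g, CPSeries_RtoC by easy. now apply f_equal. }
assert (W : x * ddgR mu x / dgR mu x = -2 * lommel_power_sums mu (x * x)).
{ assert (Z := zf2_f1_lommel_g_real mu x Hm HT). unfold zf2_f1 in Z.
  rewrite C_derive2_lommel_g, C_derive_lommel_g, !CPSeries_RtoC in Z by easy.
  change (RtoC x * RtoC (ddgR mu x) / RtoC (dgR mu x) = RtoC (-2 * lommel_power_sums mu (x * x)))%C in Z.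
  rewrite <- RtoC_mult, <- RtoC_div in Z by easy. now injection Z. }
assert (P : 0 < Rpower x (mu - 1/2)) by apply exp_pos.
assert (Hmm : mu * (mu + 1) <> 0) by (apply Rmult_integral_contrapositive; split; lra).
assert (HD : uc_denominator mu x <> 0).
{ rewrite uc_denominator_dgR by easy.
  repeat (apply Rmult_integral_contrapositive; split); try lra.
  now apply Rinv_neq_0_compat. }
assert (Q : 1/2 + mu - x * (uc_numerator mu x / uc_denominator mu x) = 2 * lommel_power_sums mu (x * x)).
{ rewrite uc_denominator_dgR, uc_numerator_gR by easy.
  replace (2 * lommel_power_sums mu (x * x)) with (- (x * ddgR mu x / dgR mu x)) by (rewrite W; ring).
  field. repeat split; try lra; easy. }
unfold uc_equation. rewrite Q. split.
- intros [_ E]. apply Rmult_eq_reg_r with (1 + beta); [|lra]. field_simplify; lra.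
- intros E. split; [easy|]. rewrite E. field. lra.
Qed.

(** * First positive zeros, and the theorem *)

(** The zero is the supremum of the points up to which the function is positive. *)
Lemma first_zero (f : R -> R) (b : R) :
  (forall x, continuity_pt f x) -> 0 < f 0 -> 0 < b -> f b <= 0 ->
  exists c, 0 < c <= b /\ f c = 0 /\ forall y, 0 <= y < c -> 0 < f y.
Proof.
intros Hc H0 Hb Hfb.
set (S := fun x => 0 <= x <= b /\ forall y, 0 <= y <= x -> 0 < f y).
assert (S0 : S 0).
{ split; [lra|]. intros y Hy. replace y with 0 by lra. easy. }
destruct (completeness S) as [c [Hub Hlub]].
{ exists b. intros x [Hx _]. lra. }
{ now exists 0. }
assert (Hc0 : 0 <= c) by now apply Hub.
assert (Hcb : c <= b) by (apply Hlub; intros x [Hx _]; lra).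
assert (Hlt : forall y, 0 <= y < c -> 0 < f y).
{ intros y Hy. destruct (Rlt_or_le 0 (f y)) as [|N]; [easy|exfalso].
  assert (c <= y); [|lra]. apply Hlub. intros x [Hx Hp].
  destruct (Rle_or_lt x y) as [|L]; [easy|]. specialize (Hp y ltac:(lra)). lra. }
assert (Hnear : f c <> 0 -> exists d, 0 < d /\
  forall y, Rabs (y - c) < d -> Rabs (f y - f c) < Rabs (f c)).
{ intro N. destruct (Hc c (Rabs (f c)) (Rabs_pos_lt _ N)) as [d [Hd Hy]].
  exists d. split; [easy|]. intros y Hyd.
  destruct (Req_dec y c) as [->|Ny].
  - rewrite Rminus_diag. rewrite Rabs_R0. now apply Rabs_pos_lt.
  - apply Hy. split; [split; [exact I | now apply not_eq_sym] | exact Hyd]. }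
assert (Hfc : f c = 0).
{ destruct (Req_dec (f c) 0) as [|N]; [easy|exfalso].
  destruct (Hnear N) as [d [Hd Hy]].
  destruct (Rdichotomy _ _ N) as [Neg|Pos].
  - destruct (Req_dec c 0) as [->|Nc]; [lra|].
    set (y := Rmax 0 (c - d / 2)).
    assert (Y : 0 <= y < c) by (unfold y; split; [apply Rmax_l | apply Rmax_lub_lt; lra]).
    assert (Y2 : c - d / 2 <= y) by apply Rmax_r.
    specialize (Hlt y Y). specialize (Hy y ltac:(apply Rabs_def1; lra)).
    rewrite (Rabs_left (f c)) in Hy by easy. apply Rabs_def2 in Hy. lra.
  - assert (Lcb : c < b) by (destruct (Req_dec c b) as [->|]; lra).
    set (z := Rmin b (c + d / 2)).
    assert (Z1 : c < z) by (apply Rmin_glb_lt; lra).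
    assert (Z2 : z <= c + d / 2) by apply Rmin_r.
    assert (Z3 : z <= b) by apply Rmin_l.
    assert (z <= c); [|lra]. apply Hub. split; [lra|]. intros y Y.
    destruct (Rlt_or_le y c) as [L|L]; [apply Hlt; lra|].
    specialize (Hy y ltac:(apply Rabs_def1; lra)).
    rewrite (Rabs_right (f c)) in Hy by lra. apply Rabs_def2 in Hy. lra. }
exists c. split; [|easy]. split; [|easy].
destruct (Req_dec c 0) as [E|]; [rewrite E in Hfc|]; lra.
Qed.

Lemma lommel_power_sums_solve mu v :
  -1 < mu < 1 -> 0 < v <= 1 ->
  exists r, 0 < r /\ r * r < lommel_sqr_bound mu /\ 2 * lommel_power_sums mu (r * r) = v.
Proof.
intros Hm Hv.
destruct (power_sum_series_solve _ (v / 2) (lommel_moduli_decay mu Hm) ltac:(lra))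
  as [t [[Ht0 HtT] Et]].
exists (sqrt t). rewrite sqrt_sqrt by lra. split; [now apply sqrt_lt_R0|].
split; [exact HtT|]. unfold lommel_power_sums. lra.
Qed.

Lemma lommel_power_sums_incr mu x y :
  -1 < mu < 1 -> 0 < x < y -> y * y < lommel_sqr_bound mu ->
  lommel_power_sums mu (x * x) < lommel_power_sums mu (y * y).
Proof.
intros Hm Hx HT. assert (T := lommel_sqr_bound_lt mu Hm).
apply power_sum_series_incr; [now apply lommel_moduli_decay | nra | lra].
Qed.

(** On the positive half-line the zeros are those of [g(x) / x], which is
    continuous on the whole line with value 1 at 0. *)
Lemma smallest_zero_lommel_half mu :
  -1 < mu < 1 -> mu <> 0 ->
  exists xi, is_smallest_positive (fun x => lommel_half mu x = 0) xi /\ gR mu xi = 0.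
Proof.
intros Hm H0. set (F := PSeries (PS_decr_1 (lommel_coef mu))).
assert (Ra := CV_radius_lommel_coef mu Hm).
assert (EG : forall x, gR mu x = x * F x).
{ intro x. unfold gR. rewrite PSeries_entire_split by easy. rewrite lommel_coef_0. unfold F. ring. }
assert (F0 : F 0 = 1) by (unfold F; rewrite PSeries_0; apply lommel_coef_1).
destruct (gR_takes_negative_value mu Hm H0) as [X [HX HG]].
destruct (first_zero F X) as [xi [Hxi [Exi Pxi]]].
- intro x. apply PSeries_continuity. now rewrite CV_radius_decr_1, Ra.
- lra.
- easy.
- rewrite EG in HG. nra.
- exists xi. split; [|now rewrite EG, Exi, Rmult_0_r].
  split; [lra|]. split.
  + rewrite lommel_half_gR by (try easy; lra). rewrite EG, Exi. ring.
  + intros y Hy. rewrite lommel_half_gR by (try easy; lra). rewrite EG.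
    specialize (Pxi y ltac:(lra)).
    assert (P : 0 < Rpower y (mu - 1/2)) by apply exp_pos.
    repeat (apply Rmult_integral_contrapositive; split); try lra.
    apply Rinv_neq_0_compat, Rmult_integral_contrapositive. lra.
Qed.

(** Rolle's theorem between 0 and the zero of [g]. *)
Lemma smallest_zero_derive mu xi :
  -1 < mu < 1 -> 0 < xi -> gR mu xi = 0 ->
  exists gamma, is_smallest_positive (fun x => C_derive (lommel_g mu) (RtoC x) = RtoC 0) gamma
    /\ gamma < xi.
Proof.
intros Hm Hxi E. assert (Ra := CV_radius_lommel_coef mu Hm).
destruct (MVT_cor2 (gR mu) (dgR mu) 0 xi Hxi) as [c [Ec Hc]].
{ intros c _. apply is_derive_Reals. now apply is_derive_gR. }
assert (Z : gR mu 0 = 0) by (unfold gR; rewrite PSeries_0; apply lommel_coef_0).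
rewrite E, Z in Ec.
assert (Ec' : dgR mu c = 0) by (apply Rmult_eq_reg_r with (xi - 0); lra).
destruct (first_zero (dgR mu) c) as [gamma [Hg [Eg Pg]]].
- intro x. apply PSeries_continuity. now rewrite CV_radius_derive, Ra.
- unfold dgR. rewrite PSeries_0. unfold PS_derive. rewrite lommel_coef_1. simpl. lra.
- easy.
- lra.
- assert (D : forall x, C_derive (lommel_g mu) (RtoC x) = RtoC (dgR mu x)).
  { intro x. rewrite C_derive_lommel_g by easy. apply CPSeries_RtoC. }
  exists gamma. split; [|lra]. split; [lra|]. split.
  + now rewrite D, Eg.
  + intros y Hy A. rewrite D in A. injection A as A. specialize (Pg y ltac:(lra)). lra.
Qed.

Theorem theorem2p2 (mu alpha beta : R)
  (hmu : -1 < mu < 1) (hmu0 : mu <> 0) (hmu_half : mu <> - (1/2))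
  (halpha : 0 <= alpha < 1) (hbeta : 0 <= beta) :
  exists r rc gamma1 xi1 : R,
    uniform_convexity_radius beta alpha (lommel_g mu) = Finite r /\
    is_smallest_positive (uc_equation mu alpha beta) r /\
    convexity_radius (lommel_g mu) = Finite rc /\
    is_smallest_positive (fun x => C_derive (lommel_g mu) (RtoC x) = RtoC 0) gamma1 /\
    is_smallest_positive (fun x => lommel_half mu x = 0) xi1 /\
    r <= rc /\ (alpha <> 0 \/ beta <> 0 -> r < rc) /\
    rc < gamma1 /\ gamma1 < xi1.
Proof.
assert (Ev : (1 - alpha) / (1 + beta) * (1 + beta) = 1 - alpha) by (field; lra).
assert (Hv : 0 < (1 - alpha) / (1 + beta)) by (apply Rdiv_lt_0_compat; lra).
assert (Hv1 : (1 - alpha) / (1 + beta) <= 1) by nra.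
destruct (lommel_power_sums_solve mu _ hmu (conj Hv Hv1)) as [r [Hr [HrT Wr]]].
destruct (lommel_power_sums_solve mu 1 hmu ltac:(lra)) as [rc [Hrc [HrcT Wrc]]].
destruct (smallest_zero_lommel_half mu hmu hmu0) as [xi [Hxi Gxi]].
destruct (smallest_zero_derive mu xi hmu (proj1 Hxi) Gxi) as [gamma [Hgamma Lgx]].
exists r, rc, gamma, xi.
split; [now apply uniform_convexity_radius_lommel_g|].
split.
{ split; [easy|]. split.
  - apply uc_equation_power_sums; (easy || lra).
  - intros y Hy A. assert (Y : y * y < r * r) by nra.
    apply uc_equation_power_sums in A; try (easy || lra).
    assert (B := lommel_power_sums_incr mu y r hmu Hy HrT). lra. }
split; [now apply convexity_radius_lommel_g|].
split; [easy|]. split; [easy|]. split.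
{ destruct (Rle_or_lt r rc) as [|L]; [easy|exfalso].
  assert (B := lommel_power_sums_incr mu rc r hmu ltac:(lra) HrT). lra. }
split.
{ intro Hab. destruct (Rlt_or_le r rc) as [|[L|L]]; [easy|exfalso|exfalso].
  - assert (B := lommel_power_sums_incr mu rc r hmu ltac:(lra) HrT). lra.
  - subst r. assert (E : (1 - alpha) / (1 + beta) = 1) by lra. rewrite E in Ev.
    destruct Hab; lra. }
split; [|easy].
destruct (Rlt_or_le rc gamma) as [|L]; [easy|exfalso].
destruct Hgamma as [Gpos [GE _]]. revert GE. apply C_derive_lommel_g_neq_0; [easy|].
rewrite Cmod_R, Rabs_right by lra. nra.
Qed.
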